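(* Let $\bar f_\theta$ be truncated basic operator recurrent networks with truncation parameter $\|f\|_\infty$, of width $n$ and depth $L$ (before truncation). Let $\mathbf{S}$ be a random training set consisting of $s$ independent samples from the distribution $\tau$, let $\theta(\mathbf{S})$ be a minimizer of $\mathcal{L}^{(em)}_r(\theta,\mathbf{S})$ over $\theta\in\Theta(N_0,\mathcal{R}_0)$, and let $$\mathcal{G}(\mathbf{S})=\big|\mathcal{L}_r^{(em)}(\theta(\mathbf{S}),\mathbf{S})-\mathcal{L}_r(\theta(\mathbf{S}),\tau)\big| .$$ (i) For any $\alpha\in(0,1)$ and every sufficiently small $\delta>0$ (smallness not depending on $s$), $$\mathbb{P}_{\mathbf{S}\sim\tau^s}\big[\mathcal{G}(\mathbf{S})\le2\delta\big]\ \ge\ 1-C_1\Big(\frac1\delta\Big)^{C_2}\exp\Big(-\frac{2}{(9n)^2\|f\|_\infty^4}\,s\,\delta^2\Big),\qquad( * )$$ where $$C_1=\exp\Big(164\,n^{3/2}L^2c_0^{L+1}(1+\|f\|_\infty)\exp(4\mathcal{L}_{r,0}\alpha^{-1})\Big),\qquad C_2=4nLc_0^L\exp(3\mathcal{L}_{r,0}\alpha^{-1}),$$ and $\mathcal{L}_{r,0}\le4n\|f\|_\infty^2$. (ii) Let $f$ be approximated with accuracy $\varepsilon_0$ by some network $f_{\theta_0}$ with $\theta_0\in\Theta(N_0,\mathcal{R}_0)$ and sparsity bound $R_0\ge1$, that is, $\mathcal{R}(\theta_0)=R_0$ and $\sup_{X\in\mathcal{X}}\|f(X)-f_{\theta_0}(X)\|_{\mathbb{R}^n}\le\varepsilon_0$.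 Then for all $\alpha\in(0,1)$ with $$\alpha\ge\frac1{R_0}\Big(\varepsilon_0^2+2L^2c_0^{2L}\exp(4R_0)\cdot n^2\sigma^2\Big)$$ the inequality $( * )$ holds (for every sufficiently small $\delta>0$) with constants $C_1,C_2$ satisfying $$C_1\le2\exp\Big(n^{3/2}2^{10}(1+\|f\|_\infty)(1+R_0)L^3c_0^{L+1}e^{8R_0}(1+R_0^2\alpha^{-1/2})\Big),\qquad C_2\le16nLc_0^Le^{8R_0}(1+R_0^2\alpha^{-1/2}).$$
   Context: Networks. A basic operator recurrent network of depth $L$ and width $n$ is $f_\theta(X)=h_L$, where $h_0\in\mathbb{R}^n$ is fixed with $\|h_0\|\le1$ and, for $1\le\ell\le L$, $h_\ell=b_\theta^{\ell,0}+A_\theta^{\ell,0}h_{\ell-1}+B_\theta^{\ell,0}Xh_{\ell-1}+\phi_\ell[b_\theta^{\ell,1}+A_\theta^{\ell,1}h_{\ell-1}+B_\theta^{\ell,1}Xh_{\ell-1}]$, with $\phi_\ell$ acting componentwise as a fixed leaky rectifier $y\mapsto\max(y,\eta y)$, $0\le\eta\le1$. Parameters: $\theta=(\theta_p^{\ell,i})_{(\ell,i,p)\in P}$, $\theta^{\ell,i}_p\in\mathbb{R}^n$, $P=P_1\cup P_2$, $P_1=\{(\ell,i,p):1\le\ell\le L,\ i\in\{0,1\},\ 1\le p\le4n\}$, $P_2=\{(\ell,i,0):1\le\ell\le L,\ i\in\{0,1\}\}$; $A_\theta^{\ell,i}=A^{\ell,i,(0)}+\sum_{p=1}^n\theta_{2p-1}^{\ell,i}(\theta_{2p}^{\ell,i})^T$,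 $B_\theta^{\ell,i}=B^{\ell,i,(0)}+\sum_{p=n+1}^{2n}\theta_{2p-1}^{\ell,i}(\theta_{2p}^{\ell,i})^T$, $b_\theta^{\ell,i}=\theta_0^{\ell,i}$, with fixed (non-learned) matrices $A^{\ell,i,(0)},B^{\ell,i,(0)}$. $\Theta=\{\theta\in(\mathbb{R}^n)^{\#P}:\|\theta_p^{\ell,i}\|\le1\text{ for all }(\ell,i,p)\in P\}$. $\mathcal{R}(\theta)=\frac12\sum_{(\ell,i,p)\in P_1}\|\theta_p^{\ell,i}\|$. $c_0\ge1$ is a constant with $\sum_{i=0}^1(\|A^{\ell,i,(0)}\|+\|B^{\ell,i,(0)}\|+\|b_\theta^{\ell,i}\|)\le c_0$ for all $\ell$ and $\theta\in\Theta$ (operator norms for matrices). The truncated network is $\bar f_\theta=T\circ f_\theta$, where $T$ acts componentwise by $x_j\mapsto\max(-\|f\|_\infty,\min(x_j,\|f\|_\infty))$; it has depth $L+2$. Data. $\mathcal{B}^{n\times n}(\rho)$ is the closed ball of radius $\rho$ in $\mathbb{R}^{n\times n}$ in operator norm. $f:\mathcal{B}^{n\times n}(1)\to\mathbb{R}^n$ is bounded and continuous, $\|f\|_\infty=\sup_{X\in\mathcal{B}^{n\times n}(1)}\|f(X)\|_{\mathbb{R}^n}$. $F$ is a (direct) map from a Euclidean ball $B\subset\mathbb{R}^d$ to $\mathbb{R}^{n\times n}$, $\mathcal{X}=F(B)$. $\mathbf{z}$ is a random vector with values in $B$, $\mathbf{X}=F(\mathbf{z})\in\mathcal{B}^{n\times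 n}(\frac12)$ a.s., $\mathbf{y}=f(\mathbf{X})$, and $\mathcal{E}$ is a random matrix independent of $\mathbf{X}$ with $\mathcal{E}\in\mathcal{B}^{n\times n}(\frac12)$ a.s. and $\mathbb{E}\sum_{i,j}|\mathcal{E}_{ij}|^2=n^2\sigma^2$. $\mathbf{M}=\mathbf{X}+\mathcal{E}$, and $\tau$ is the distribution of $(\mathbf{M},\mathbf{y})$. Losses. For regularization parameter $\alpha\in(0,1)$: $\mathcal{L}_r(\theta,\tau)=\mathbb{E}_{(\mathbf{M},\mathbf{y})\sim\tau}[\|\bar f_\theta(\mathbf{M})-\mathbf{y}\|^2+\alpha\mathcal{R}(\theta)]$; for $S=\{(X_j,y_j)\}_{j=1}^s$, $\mathcal{L}_r^{(em)}(\theta,S)=\frac1s\sum_{j=1}^s\|\bar f_\theta(X_j)-y_j\|^2+\alpha\mathcal{R}(\theta)$. Constants. Approximation condition: for given $\varepsilon_0,R_0$ there is $\theta_0\in\Theta$ with $\mathcal{R}(\theta_0)=R_0$ and $\sup_{X\in\mathcal{X}}\|f(X)-f_{\theta_0}(X)\|\le\varepsilon_0$. If it holds, $\mathcal{L}_{r,0}=\min\big(4n\|f\|_\infty^2,\ 2\varepsilon_0^2+2\alpha R_0+2L^2c_0^{2L}\exp(2\varepsilon_0^2/\alpha+2R_0)\,n^2\sigma^2\big)$; if it is not assumed, $\mathcal{L}_{r,0}=4n\|f\|_\infty^2$. $\mathcal{R}_0=\mathcal{L}_{r,0}/\alpha$ (distinct from $R_0$). $N_1=\lfloor2Lc_0^L\mathcal{R}_0^{3/2}\alpha^{-1/2}\exp(2\mathcal{R}_0)\rfloor$,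 $N_0=N_1+2L+1$, and $\Theta(N_0,\mathcal{R}_0)=\{\theta\in\Theta:\mathcal{N}_1(\theta)\le N_1,\ \mathcal{R}(\theta)\le\mathcal{R}_0\}$, where $\mathcal{N}_1(\theta)$ is the number of $(\ell,i,p)\in P_1$ with $\theta_p^{\ell,i}\ne0$. *)

(* Defs.v *)
From HB Require Import structures.
From mathcomp Require Import all_boot all_order all_algebra.
From mathcomp Require Import all_classical all_reals all_analysis.

Set Implicit Arguments.
Unset Strict Implicit.
Unset Printing Implicit Defensive.

Import Order.TTheory GRing.Theory Num.Theory.
Import numFieldNormedType.Exports.

Local Open Scope classical_set_scope.
Local Open Scope ring_scope.

(* The norm that the library attaches to matrices is the sup norm; the
   topology, hence continuity, is the same. *)
Definition enorm (R : realType) (n : nat) (v : 'cV[R]_n) : R :=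
  Num.sqrt (\sum_(i < n) v i 0 ^+ 2).

Definition opnorm (R : realType) (m n : nat) (A : 'M[R]_(m, n)) : R :=
  sup [set enorm (A *m v) | v in [set v : 'cV[R]_n | enorm v <= 1]].

Definition opball (R : realType) (n : nat) (rho : R) : set 'M[R]_n :=
  [set X | opnorm X <= rho].
Arguments opball {R} n rho.

(* Nondegenerate balls of R^d, open or closed. *)
Definition euclidean_ball (R : realType) (d : nat) (B : set 'cV[R]_d) : Prop :=
  exists (c : 'cV[R]_d) (r : R), 0 < r /\
    (B = [set v | enorm (v - c) <= r] \/ B = [set v | enorm (v - c) < r]).

(* Matrices carry the product sigma-algebra of the Borel sets of R, i.e. the
   Borel sigma-algebra of R^(m * n), as the library does for tuples. *)
Definition mx_coord_sets (R : realType) (m n : nat) : set (set 'M[R]_(m, n)) :=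
  \bigcup_(ij in [set: 'I_m * 'I_n])
    preimage_set_system setT (fun A : 'M[R]_(m, n) => A ij.1 ij.2) measurable.

Definition mx_display : measure_display.
Proof. exact: default_measure_display. Qed.

Section matrix_measurable.
Context (R : realType) (m n : nat).

Let mx_measurable : set (set 'M[R]_(m, n)) := <<s @mx_coord_sets R m n >>.

Let mx_measurable0 : mx_measurable set0.
Proof. exact: sigma_algebra0. Qed.

Let mx_measurableC A : mx_measurable A -> mx_measurable (~` A).
Proof. exact: sigma_algebraC. Qed.

Let mx_measurable_bigcup (F : (set 'M[R]_(m, n))^nat) :
  (forall i, mx_measurable (F i)) -> mx_measurable (\bigcup_i F i).
Proof. exact: sigma_algebra_bigcup. Qed.

HB.instance Definition _ := @isMeasurable.Build mx_display
  'M[R]_(m, n) mx_measurable mx_measurable0 mx_measurableC mx_measurable_bigcup.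

End matrix_measurable.

Definition pair_fun (T T1 T2 : Type) (X : T -> T1) (Y : T -> T2) : T -> T1 * T2 :=
  fun w => (X w, Y w).

Section pair_measurable.
Context d d1 d2 (T : measurableType d) (T1 : measurableType d1)
  (T2 : measurableType d2) (X : {mfun T >-> T1}) (Y : {mfun T >-> T2}).

Let measurable_pair_fun : measurable_fun setT (pair_fun X Y).
Proof. exact: measurable_fun_pair. Qed.

HB.instance Definition _ :=
  isMeasurableFun.Build _ _ _ _ (pair_fun X Y) measurable_pair_fun.

End pair_measurable.

Definition independent_RV d d1 d2 (T : measurableType d) (T1 : measurableType d1)
    (T2 : measurableType d2) (R : realType) (P : probability T R)
    (X : {RV P >-> T1}) (Y : {RV P >-> T2}) : Prop :=
  forall (A : set T1) (B : set T2), measurable A -> measurable B ->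
    P (X @^-1` A `&` Y @^-1` B) = (P (X @^-1` A) * P (Y @^-1` B))%E.

Definition mutually_independent d d' (T : measurableType d)
    (T' : measurableType d') (R : realType) (P : probability T R) (I : finType)
    (S : I -> {RV P >-> T'}) : Prop :=
  forall (J : {set I}) (A : I -> set T'),
    (forall j, j \in J -> measurable (A j)) ->
    P (\bigcap_(j in [set` J]) (S j @^-1` A j)) =
    (\prod_(j in J) P (S j @^-1` A j))%E.

(* Inner probability. It is the probability on events (next lemma); a minimizer
   of the empirical loss need not depend measurably on the training set, and
   then this still gives a meaning to the probability of a statement on it. *)
Definition inner_prob d (T : measurableType d) (R : realType)
    (P : probability T R) (A : set T) : \bar R :=
  ereal_sup [set P E | E in [set E | measurable E /\ E `<=` A]].

Lemma inner_prob_measurable d (T : measurableType d) (R : realType)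
    (P : probability T R) (A : set T) :
  measurable A -> inner_prob P A = P A.
Proof.
move=> mA; apply/eqP; rewrite eq_le; apply/andP; split.
  apply: ge_ereal_sup => _ [E [mE EA] <-].
  by apply: le_measure; rewrite ?inE.
by apply: ereal_sup_ubound; exists A => //; split.
Qed.

(* Layers, numbered from 1 to L on paper, are indexed by 'I_L. *)
Record architecture (R : realType) (n L : nat) := Architecture {
  net_h0 : 'cV[R]_n ;
  net_eta : 'I_L -> R ;
  net_A0 : 'I_L -> 'I_2 -> 'M[R]_n ;
  net_B0 : 'I_L -> 'I_2 -> 'M[R]_n
}.

Definition admissible_architecture (R : realType) (n L : nat)
    (a : architecture R n L) : Prop :=
  enorm (net_h0 a) <= 1 /\ (forall l, 0 <= net_eta a l <= 1).

Definition param_index (n L : nat) : finType := ('I_L * 'I_2 * 'I_(4 * n).+1)%type.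

Definition in_P1 (n L : nat) (k : param_index n L) : bool := k.2 != ord0.

Definition param (R : realType) (n L : nat) : Type :=
  {ffun param_index n L -> 'cV[R]_n}.

Section networks.
Context (R : realType) (n L : nat).
Implicit Types (a : architecture R n L) (th : param R n L) (l : 'I_L)
  (i : 'I_2) (X : 'M[R]_n) (h : 'cV[R]_n).

Definition net_b th l i : 'cV[R]_n := th (l, i, ord0).

Definition rank_one th l i (p : nat) : 'M[R]_n :=
  th (l, i, inord (2 * p).-1) *m (th (l, i, inord (2 * p)))^T.

Definition net_A a th l i : 'M[R]_n :=
  net_A0 a l i + \sum_(1 <= p < n.+1) rank_one th l i p.

Definition net_B a th l i : 'M[R]_n :=
  net_B0 a l i + \sum_(n.+1 <= p < (2 * n).+1) rank_one th l i p.

Definition leaky (eta : R) h : 'cV[R]_n :=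
  \col_j Num.max (h j 0) (eta * h j 0).

Definition affine_part a th X l i h : 'cV[R]_n :=
  net_b th l i + net_A a th l i *m h + net_B a th l i *m (X *m h).

Definition layer a th X h l : 'cV[R]_n :=
  affine_part a th X l ord0 h + leaky (net_eta a l) (affine_part a th X l ord_max h).

Definition network a th X : 'cV[R]_n :=
  foldl (layer a th X) (net_h0 a) (enum 'I_L).

Definition truncate (c : R) h : 'cV[R]_n :=
  \col_j Num.max (- c) (Num.min (h j 0) c).

Definition truncated_network a (c : R) th X : 'cV[R]_n :=
  truncate c (network a th X).

Definition Theta : set (param R n L) := [set th | forall k, enorm (th k) <= 1].

Definition regularizer th : R := 2^-1 * \sum_(k | in_P1 k) enorm (th k).

Definition num_active th : nat :=
  #|[pred k : param_index n L | in_P1 k && (th k != 0)]|.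

(* Theta(N0, r): the condition is num_active th <= N1 with N0 = N1 + 2L + 1. *)
Definition Theta_sparse (N0 : nat) (r : R) : set (param R n L) :=
  [set th | [/\ Theta th, (num_active th + (2 * L).+1 <= N0)%N
              & regularizer th <= r]].

Definition fixed_weights_bound a (c0 : R) : Prop :=
  forall th l, Theta th ->
    \sum_(i < 2) (opnorm (net_A0 a l i) + opnorm (net_B0 a l i)
                  + enorm (net_b th l i)) <= c0.

End networks.

Arguments Theta {R n L}.
Arguments Theta_sparse {R n L} N0 r.

Definition sup_norm (R : realType) (n : nat) (f : 'M[R]_n -> 'cV[R]_n) : R :=
  sup [set enorm (f X) | X in opball n 1].

(* The target f only has a meaning on opball n 1, so the supremum over the
   range of the direct map is taken over its points in that ball. *)
Definition approximates (R : realType) (n L : nat) (a : architecture R n L)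
    (f : 'M[R]_n -> 'cV[R]_n) (XX : set 'M[R]_n) (eps0 : R) (th0 : param R n L) :
    Prop :=
  (ereal_sup [set (enorm (f X - network a th0 X))%:E | X in XX `&` opball n 1]
   <= eps0%:E)%E.

(* The last argument is Some (eps0, R0) when the approximation condition is
   assumed with these values, and None when it is not assumed. *)
Definition Lr0 (R : realType) (n L : nat) (c0 sigma fsup alpha : R)
    (ap : option (R * R)) : R :=
  if ap is Some (eps0, R0) then
    Num.min (4 * n%:R * fsup ^+ 2)
      (2 * eps0 ^+ 2 + 2 * alpha * R0
       + 2 * L%:R ^+ 2 * c0 ^+ (2 * L) * expR (2 * eps0 ^+ 2 / alpha + 2 * R0)
         * (n%:R ^+ 2 * sigma ^+ 2))
  else 4 * n%:R * fsup ^+ 2.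

(* [Num.truncn] is the floor on nonnegative reals. *)
Definition N1 (R : realType) (L : nat) (c0 alpha calR0 : R) : nat :=
  Num.truncn (2 * L%:R * c0 ^+ L * calR0 `^ (3 / 2) * alpha `^ (- (1 / 2))
              * expR (2 * calR0)).

Definition N0 (R : realType) (L : nat) (c0 alpha calR0 : R) : nat :=
  (N1 L c0 alpha calR0 + 2 * L + 1)%N.

Definition admissible_params (R : realType) (n L : nat) (c0 alpha lr0 : R) :
    set (param R n L) :=
  Theta_sparse (N0 L c0 alpha (lr0 / alpha)) (lr0 / alpha).
Arguments admissible_params {R n L} c0 alpha lr0.

Section losses.
Context (R : realType) (n L : nat) (a : architecture R n L) (fsup alpha : R).
Local Notation data := ('M[R]_n * 'cV[R]_n)%type.

Definition sq_error (th : param R n L) (D : data) : R :=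
  enorm (truncated_network a fsup th D.1 - D.2) ^+ 2.

Definition expected_loss (tau : probability data R) (th : param R n L) : \bar R :=
  ('E_tau[fun D => (sq_error th D + alpha * regularizer th)%R])%E.

Definition empirical_loss (s : nat) (S : 'I_s -> data) (th : param R n L) : R :=
  s%:R^-1 * \sum_(j < s) sq_error th (S j) + alpha * regularizer th.

Definition generalization_gap (tau : probability data R) (s : nat)
    (th : ('I_s -> data) -> param R n L) (S : 'I_s -> data) : \bar R :=
  (`| (empirical_loss S (th S))%:E - expected_loss tau (th S) |)%E.

End losses.

Definition is_minimizer (T : Type) (R : realType) (g : T -> R) (A : set T) (x : T) :
    Prop :=
  A x /\ forall y, A y -> g x <= g y.

(* The tail bound with constants C1, C2. The probability space carrying the
   training set is arbitrary, so that the statement is about the law tau^s. *)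
Definition gap_bound (R : realType) (n L : nat) (a : architecture R n L)
    (c0 fsup alpha lr0 : R) (tau : probability ('M[R]_n * 'cV[R]_n)%type R)
    (C1 C2 : R) : Prop :=
  \forall delta \near (0 : R)^'+,
  forall (s : nat), (0 < s)%N ->
  forall (dS : measure_display) (OmegaS : measurableType dS)
         (PS : probability OmegaS R)
         (S : 'I_s -> {RV PS >-> ('M[R]_n * 'cV[R]_n)%type}),
    (forall j A, measurable A -> distribution PS (S j) A = tau A) ->
    mutually_independent S ->
  forall th : ('I_s -> 'M[R]_n * 'cV[R]_n) -> param R n L,
    (forall D, is_minimizer (empirical_loss a fsup alpha D)
                 (admissible_params c0 alpha lr0) (th D)) ->
  ((1 - C1 * delta^-1 `^ C2
        * expR (- (2 / ((9 * n%:R) ^+ 2 * fsup ^+ 4) * s%:R * delta ^+ 2)))%:E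
   <= inner_prob PS
        [set w | (generalization_gap a fsup alpha tau th (fun j => S j w)
                  <= (2 * delta)%:E)%E])%E.

(* Main.v *)
Require Import Defs.
From HB Require Import structures.
From mathcomp Require Import all_boot all_order all_algebra.
From mathcomp Require Import all_classical all_reals all_analysis.
From mathcomp Require Import measurable_realfun ring lra.

Set Implicit Arguments.
Unset Strict Implicit.
Unset Printing Implicit Defensive.

Import Order.TTheory GRing.Theory Num.Theory.
Import numFieldNormedType.Exports.

Local Open Scope classical_set_scope.
Local Open Scope ring_scope.

(** For every C1 >= 1 and C2 > 0 the tail bound holds for all small delta, and
    both parts of the theorem follow, part (ii) with C1 = 1 and with the stated
    upper bound itself as C2.

    The minimizer may be any function of the training set, so the empirical and
    the expected loss are compared simultaneously for all parameters in a box
    that contains Theta. The regularizer cancels, and what remains is a uniform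
    law of large numbers for the squared errors, which take values in [0, r]
    with r = 4 n |f|^2 almost surely ([sq_error_bound], [data_law_box]) and
    which are Lipschitz in the parameters uniformly over the data
    ([tame_sq_error]).

    For a single function, Hoeffding's inequality ([hoeffding_two_sided]) bounds
    the probability of a deviation beyond t of the empirical mean by
    2 exp(- s t^2 / (4 r^2)). At t = (3/2) delta the exponent is
    (9/16) s delta^2 / r^2, strictly more than the exponent
    2 s delta^2 / ((9 n)^2 |f|^4) = (32/81) s delta^2 / r^2 that is claimed, and
    delta / 2 is left over for the passage to all parameters.

    A union bound over a net of mesh delta would produce a factor of order
    delta^-D, with D the number of scalar parameters, and D may exceed C2. So
    two nets are used ([uniform_deviation]). The coarse one has a fixed mesh and
    hence a number of points independent of delta. The fine one has mesh of
    order delta; its points are compared only with their coarse neighbours, and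
    these increments are so small that Hoeffding's inequality gives them a large
    multiple q + 1 of the target exponent. Unless the claim is trivial,
    exp(- (32/81) s delta^2 / r^2) < delta^C2, so the surplus is at most
    delta^(q C2) <= delta^D and absorbs the cardinality of the fine net
    ([two_scale_count]). The factor delta^-C2 tends to infinity and absorbs the
    remaining constants for small delta. *)

(** * Hoeffding's inequality for samples of a law *)

(** From exp x <= 1 / (1 - x), used at y itself when y <= 0 and at y / 2 when
    y > 0. A second-order upper bound valid near 0 is enough for the moment
    estimate below, because the exponential parameter is taken small. *)
Lemma expR_le_quadratic (R : realType) (y : R) :
  y <= 1 / 3 -> expR y <= 1 + y + y ^+ 2.
Proof.
move=> y_le.
have inv_le (x : R) : x < 1 -> expR x <= (1 - x)^-1.
  move=> x_lt; have x1 : 0 < 1 - x by lra.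
  rewrite -[x in expR x]opprK expRN lef_pV2 ?posrE ?expR_gt0 //.
  exact: expR_ge1Dx.
have [y0|y0] := leP y 0.
  have y1 : 0 < 1 - y by lra.
  apply: (le_trans (inv_le _ _)); first by lra.
  rewrite -[_^-1]mul1r ler_pdivrMr //.
  have : 0 <= (- y) * y ^+ 2 by rewrite mulr_ge0 ?sqr_ge0 //; lra.
  lra.
have y1 : 0 < 1 - y / 2 by lra.
rewrite [y in expR y](_ : y = 2%:R * (y / 2)); last by field.
rewrite expRM_natl.
apply: (@le_trans _ _ ((1 - y / 2)^-1 ^+ 2)).
  rewrite lerXn2r ?nnegrE ?expR_ge0 ?invr_ge0 ?(ltW y1) //.
  by apply: inv_le; lra.
rewrite exprVn -[_^-1]mul1r ler_pdivrMr ?exprn_gt0 //.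
have -> : (1 + y + y ^+ 2) * (1 - y / 2) ^+ 2
    = 1 + y ^+ 2 / 4 * ((1 - 3 * y) + y ^+ 2) by field.
have : 0 <= y ^+ 2 / 4 * ((1 - 3 * y) + y ^+ 2).
  have := sqr_ge0 y; move: (y ^+ 2) => q q0.
  by apply: mulr_ge0; lra.
lra.
Qed.

Lemma bounded_integrable d (T : measurableType d) (R : realType)
    (P : probability T R) (g : T -> R) (r : R) :
  measurable_fun setT g -> (forall x, `|g x| <= r) ->
  P.-integrable setT (EFin \o g).
Proof.
move=> mg gr; apply: measurable_bounded_integrable => //.
  exact: le_lt_trans (probability_le1 P measurableT) (ltry _).
exists r; split; first exact: num_real.
by move=> M rM x _ /=; apply: le_trans (gr x) (ltW rM).
Qed.

Lemma Rintegral_prob_cst d (T : measurableType d) (R : realType)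
    (P : probability T R) (c : R) : \int[P]_x c = c.
Proof.
by rewrite Rintegral_cst // [X in fine X](@probability_setT _ _ _ P) mulr1.
Qed.

(** The first-order term of the quadratic upper bound integrates to 0, so that
    only the variance term, at most lam^2 r^2, survives. The constant is not
    the optimal 1/8 of Hoeffding's lemma, but the tail bounds below have room
    for it. *)
Lemma exp_moment_le d (T : measurableType d) (R : realType)
    (P : probability T R) (g : T -> R) (r lam : R) :
  let mu := \int[P]_x g x in
  measurable_fun setT g -> (forall x, `|g x - mu| <= r) ->
  0 <= lam -> lam * r <= 1 / 3 ->
  \int[P]_x expR (lam * (g x - mu)) <= expR (lam ^+ 2 * r ^+ 2).
Proof.
move=> mu mg gr lam0 lamr.
have lg x : `|lam * (g x - mu)| <= lam * r.
  by rewrite normrM (ger0_norm lam0) ler_wpM2l.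
have mgc : measurable_fun setT (fun x => g x - mu).
  by apply: measurable_funD => //; exact: measurable_cst.
have mlg : measurable_fun setT (fun x => lam * (g x - mu)).
  by apply: measurable_funM => //; exact: measurable_cst.
have ig : P.-integrable setT (EFin \o g).
  apply: (@bounded_integrable _ _ _ _ _ (r + `|mu|)) => // x.
  by rewrite -[g x](subrK mu); apply: le_trans (ler_normD _ _) _; rewrite lerD2r.
have igc : P.-integrable setT (EFin \o (fun x => g x - mu)).
  exact: bounded_integrable gr.
have ilg : P.-integrable setT (EFin \o (fun x => lam * (g x - mu))).
  exact: bounded_integrable lg.
have ic c : P.-integrable setT (EFin \o cst c).
  exact: finite_measure_integrable_cst.
apply: (le_trans _ (expR_ge1Dx _)).
apply: (@le_trans _ _
    (\int[P]_x (lam * (g x - mu) + (1 + lam ^+ 2 * r ^+ 2)))).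
  apply: le_Rintegral => //.
  - apply: (@bounded_integrable _ _ _ _ _ (expR (lam * r))).
      exact: measurableT_comp.
    by move=> x; rewrite ger0_norm ?expR_ge0 // ler_expR (le_trans (ler_norm _)).
  - apply: (@bounded_integrable _ _ _ _ _ (lam * r + `|1 + lam ^+ 2 * r ^+ 2|)).
      by apply: measurable_funD => //; exact: measurable_cst.
    by move=> x; apply: le_trans (ler_normD _ _) _; rewrite lerD2r.
  - move=> x _; apply: (le_trans (expR_le_quadratic _)).
      by apply: le_trans (ler_norm _) _; apply: le_trans lamr.
    have : (lam * (g x - mu)) ^+ 2 <= lam ^+ 2 * r ^+ 2.
      rewrite -exprMn -[X in X <= _]real_normK ?num_real //.
      by rewrite lerXn2r ?nnegrE ?normr_ge0 // (le_trans _ (lg x)).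
    by rewrite -addrA addrCA => ?; rewrite lerD2l lerD2l.
rewrite RintegralD //; last exact: ic.
rewrite RintegralZl // RintegralB //; last exact: ic.
rewrite (Rintegral_prob_cst P mu) subrr mulr0 add0r.
by rewrite (Rintegral_prob_cst P (1 + lam ^+ 2 * r ^+ 2)).
Qed.

Lemma measure_le_sum d (T : measurableType d) (R : realType)
    (P : probability T R) (I : finType) (Q : pred I) (A : set T)
    (B : I -> set T) :
  measurable A -> (forall i, measurable (B i)) ->
  (forall w, A w -> exists2 i, Q i & B i w) ->
  (P A <= \sum_(i | Q i) P (B i))%E.
Proof.
move=> mA mB AB.
apply: (@le_trans _ _ (P (\big[setU/set0]_(i | Q i) B i))).
  apply: le_measure; rewrite ?inE //; first exact: bigsetU_measurable.
  by move=> w /AB[i Qi Bi]; rewrite (bigD1 i) //=; left.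
elim: (index_enum I) => [|i l IH]; first by rewrite !big_nil measure0.
rewrite !big_cons; case: ifP => // Qi.
by rewrite (le_trans (measureU2 _ _ _)) ?leeD2l //; apply: bigsetU_measurable.
Qed.

Definition iid_sample d d' (T : measurableType d) (Om : measurableType d')
    (R : realType) (tau : probability T R) (P : probability Om R) (s : nat)
    (S : 'I_s -> {RV P >-> T}) : Prop :=
  (forall j A, measurable A -> distribution P (S j) A = tau A) /\
  mutually_independent S.

Lemma sum_Rintegral_fibres d (T : measurableType d) (R : realType)
    (P : probability T R) (I : finType) (k : T -> I) (h : T -> R) (K : R) :
  (forall i, measurable (k @^-1` [set i])) ->
  measurable_fun setT h -> (forall x, 0 <= h x <= K) ->
  \sum_i \int[P]_(x in k @^-1` [set i]) h x = \int[P]_x h x.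
Proof.
move=> mk mh hK.
have ih : P.-integrable setT (EFin \o h).
  apply: (bounded_integrable P (r := K) mh) => x.
  by rewrite ger0_norm; case/andP: (hK x).
apply: EFin_inj; rewrite -sumEFin.
have -> : (\sum_i (\int[P]_(x in k @^-1` [set i]) h x)%:E
    = \sum_i \int[P]_(x in k @^-1` [set i]) (h x)%:E)%E.
  apply: eq_bigr => i _; rewrite fineK //.
  apply: (integrable_fin_num (mk i)).
  exact: (integrableS measurableT (mk i) _ ih).
rewrite fineK; last exact: (integrable_fin_num measurableT ih).
have UT : \big[setU/set0]_i (k @^-1` [set i]) = setT.
  by apply/seteqP; split => // x _; rewrite (bigD1 (k x)) //=; left.
rewrite -ge0_integral_bigsetU ?UT //.
- exact: index_enum_uniq.
- by move=> i j _ _ [x [/= <- <-]].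
- exact/measurable_EFinP.
- by move=> x _; rewrite lee_fin; case/andP: (hK x).
Qed.

Lemma measurable_sample_sum_ge d d' (T : measurableType d)
    (Om : measurableType d') (R : realType) (P : probability Om R) (s : nat)
    (S : 'I_s -> {RV P >-> T}) (g : T -> R) (c : R) :
  measurable_fun setT g -> measurable [set w | c <= \sum_j g (S j w)].
Proof.
move=> mg; rewrite [X in measurable X](_ : _ =
    (fun w => \sum_j g (S j w)) @^-1` `[c, +oo[); last first.
  by apply/seteqP; split => w /=; rewrite in_itv /= andbT.
rewrite -[X in measurable X]setTI.
apply: (@measurable_sum _ _ _ _ _ _ (fun j w => g (S j w))) => // j.
exact: measurableT_comp.
Qed.

(** Chernoff's method on a discretization. The range of g is cut into cells of
    length xi, so that the sample is described by finitely many words v, and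
    mutual independence gives the probability of each word as a product. The
    exponential sum over the words then factorizes by distributivity, and each
    factor is at most an exponential moment of g. Rounding costs the term xi. *)
Lemma hoeffding_discretized d d' (T : measurableType d) (Om : measurableType d')
    (R : realType) (tau : probability T R) (P : probability Om R) (s : nat)
    (S : 'I_s -> {RV P >-> T}) (g : T -> R) (lo r lam t xi : R) :
  let mu := \int[tau]_x g x in
  iid_sample tau S -> measurable_fun setT g ->
  (forall x, lo <= g x <= lo + r) -> 0 <= lam -> lam * r <= 1 / 3 -> 0 < xi ->
  (P [set w | (s%:R * (mu + t) <= \sum_j g (S j w))%R]
   <= (expR (s%:R * (lam * (xi - t) + lam ^+ 2 * r ^+ 2))%R)%:E)%E.
Proof.
move=> mu [law ind] mg gb lam0 lamr xi0.
have ig : tau.-integrable setT (EFin \o g).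
  apply: (@bounded_integrable _ _ _ _ _ (`|lo| + `|r|)) => // x.
  have /andP[g1 g2] := gb x.
  rewrite ler_norml; have := ler_norm (- lo); have := ler_norm lo.
  by have := ler_norm r; have := normr_ge0 r; rewrite normrN; lra.
have mub : lo <= mu <= lo + r.
  rewrite -{1}(Rintegral_prob_cst tau lo) -{1}(Rintegral_prob_cst tau (lo + r)).
  by apply/andP; split; apply: le_Rintegral => //;
    [exact: finite_measure_integrable_cst|move=> x _; case/andP: (gb x)
    |exact: finite_measure_integrable_cst|move=> x _; case/andP: (gb x)].
have gr x : `|g x - mu| <= r.
  by move: (gb x) mub => /andP[? ?] /andP[? ?]; rewrite ler_norml; lra.
pose m := Num.truncn (r / xi).
(* k x is the cell of g x, and c i is the left end of the i-th cell. *)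
pose k x : 'I_m.+1 := inord (Num.truncn ((g x - lo) / xi)).
pose c (i : 'I_m.+1) := lo + xi * i%:R.
have gpos x : 0 <= (g x - lo) / xi.
  by rewrite divr_ge0 ?(ltW xi0) // subr_ge0; case/andP: (gb x).
have kE x : k x = Num.truncn ((g x - lo) / xi) :> nat.
  rewrite inordK // ltnS le_truncn // ler_pM2r ?invr_gt0 //.
  by rewrite lerBlDl; case/andP: (gb x).
have kg x : c (k x) <= g x < c (k x) + xi.
  have := truncn_itv (gpos x); rewrite -kE ler_pdivlMr // ltr_pdivrMr //.
  by rewrite /c -natr1; lra.
have mk i : measurable (k @^-1` [set i]).
  have -> : k @^-1` [set i] = g @^-1` `[c i, c i + xi[.
    apply/seteqP; split => x /=; first by move=> <-; rewrite in_itv /= kg.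
    rewrite in_itv /= => /andP[ci1 ci2]; apply/val_inj; rewrite /= kE.
    apply: truncn_def; rewrite ler_pdivlMr // ltr_pdivrMr // -natr1.
    by move: ci1 ci2; rewrite /c; lra.
  rewrite -[X in measurable X]setTI; apply: mg => //.
pose p i := fine (tau (k @^-1` [set i])).
have pE i j : P (S j @^-1` (k @^-1` [set i])) = (p i)%:E.
  by rewrite fineK ?fin_num_measure //; exact: (law j _ (mk i)).
have p0 i : 0 <= p i by exact: fine_ge0.
have moment : \sum_i p i * expR (lam * (c i - mu)) <= expR (lam ^+ 2 * r ^+ 2).
  apply: le_trans (exp_moment_le mg gr lam0 lamr).
  have mexp : measurable_fun setT (fun x => expR (lam * (g x - mu))).
    apply: measurableT_comp => //; apply: measurable_funM => //.
    by apply: measurable_funD => //; exact: measurable_cst.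
  have bexp x : 0 <= expR (lam * (g x - mu)) <= expR (lam * r).
    rewrite expR_ge0 ler_expR /= ler_wpM2l //.
    exact: le_trans (ler_norm _) (gr x).
  rewrite -(sum_Rintegral_fibres tau mk mexp bexp).
  apply: ler_sum => i _.
  rewrite mulrC -(Rintegral_cst tau (mk i)).
  apply: le_Rintegral => //.
  - apply: (integrableS measurableT (mk i)) => //.
    exact: finite_measure_integrable_cst.
  - apply: (integrableS measurableT (mk i)) => //.
    apply: (bounded_integrable tau (r := expR (lam * r)) mexp) => x.
    by rewrite ger0_norm; case/andP: (bexp x).
  - move=> x <-; rewrite ler_expR ler_wpM2l // lerD2r.
    by case/andP: (kg x).
(* Words that reach the threshold after rounding up; they cover the event. *)
pose Q (v : {ffun 'I_s -> 'I_m.+1}) := s%:R * (mu + t) <= \sum_j (c (v j) + xi).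
pose cyl (v : {ffun 'I_s -> 'I_m.+1}) :=
  \bigcap_(j in [set` [set: 'I_s]%SET]) (S j @^-1` (k @^-1` [set v j])).
have mcyl v : measurable (cyl v).
  by apply: fin_bigcap_measurable => // j _; exact: measurable_funPTI.
have Pcyl v : P (cyl v) = (\prod_j p (v j))%:E.
  rewrite /cyl ind => [|j _ //]; rewrite -prodEFin.
  by apply: eq_big => [j|j _]; rewrite ?inE ?pE.
apply: (le_trans (@measure_le_sum _ _ _ P _ Q _ cyl _ _ _)) => //.
- exact: measurable_sample_sum_ge.
- move=> w /= Hw; exists [ffun j => k (S j w)].
    apply: le_trans Hw _; apply: ler_sum => j _; rewrite ffunE ltW //.
    by case/andP: (kg (S j w)).
  by move=> j _ /=; rewrite ffunE.
under eq_bigr do rewrite Pcyl.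
rewrite sumEFin lee_fin.
apply: (@le_trans _ _ (\sum_(v : {ffun 'I_s -> 'I_m.+1})
    \prod_j (p (v j) * expR (lam * (c (v j) - mu)) * expR (lam * (xi - t))))).
  rewrite big_mkcond; apply: ler_sum => v _.
  have prod0 (F : 'I_s -> R) : (forall j, 0 <= F j) -> 0 <= \prod_j F j.
    by move=> F0; apply: prodr_ge0.
  case: ifP => [Qv|_]; last by apply: prod0 => j; rewrite !mulr_ge0 ?expR_ge0.
  under [leRHS]eq_bigr do rewrite -mulrA -expRD -mulrDr.
  rewrite big_split /= ler_peMr ?prod0 // -expR_sum -mulr_sumr.
  rewrite (le_trans _ (expR_ge1Dx _)) // lerDl mulr_ge0 //.
  have -> : \sum_(i < s) (c (v i) - mu + (xi - t))
      = \sum_(i < s) (c (v i) + xi) - s%:R * (mu + t).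
    rewrite mulr_natl -[X in _ *+ X](card_ord s) -sumr_const -sumrB.
    by apply: eq_bigr => i _; ring.
  by rewrite subr_ge0.
rewrite -(bigA_distr_bigA (fun _ i =>
  p i * expR (lam * (c i - mu)) * expR (lam * (xi - t)))) /=.
rewrite prodr_const card_ord expRM_natl lerXn2r ?nnegrE ?expR_ge0 //.
  by apply: sumr_ge0 => i _; rewrite !mulr_ge0 ?expR_ge0.
by rewrite -mulr_suml expRD [leLHS]mulrC ler_wpM2l ?expR_ge0.
Qed.

(** The limit of the discretized bound as xi tends to 0, with the parameter
    lam = t / (2 r^2) that minimizes lam^2 r^2 - lam t. The condition on t is
    lam r <= 1/3, the range in which the quadratic bound on exp holds. *)
Lemma hoeffding d d' (T : measurableType d) (Om : measurableType d')
    (R : realType) (tau : probability T R) (P : probability Om R) (s : nat)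
    (S : 'I_s -> {RV P >-> T}) (g : T -> R) (lo r t : R) :
  let mu := \int[tau]_x g x in
  iid_sample tau S -> measurable_fun setT g ->
  (forall x, lo <= g x <= lo + r) -> 0 < r -> 0 <= t <= 2 / 3 * r ->
  (P [set w | (s%:R * (mu + t) <= \sum_j g (S j w))%R]
   <= (expR (- (s%:R * t ^+ 2 / (4 * r ^+ 2)))%R)%:E)%E.
Proof.
move=> mu iid mg gb r0 /andP[t0 tr].
set A := [set _ | _].
have mA : measurable A by exact: measurable_sample_sum_ge.
pose lam := t / (2 * r ^+ 2).
have r2 : 0 < r ^+ 2 by rewrite exprn_gt0.
have lam0 : 0 <= lam by rewrite divr_ge0 // mulr_ge0 // ltW.
have lamr : lam * r <= 1 / 3.
  have -> : lam * r = t / (2 * r) by rewrite /lam; field; rewrite gt_eqF.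
  by rewrite ler_pdivrMr ?mulr_gt0 //; lra.
have PA : P A = (fine (P A))%:E by rewrite fineK // fin_num_measure.
rewrite PA lee_fin.
have [p0|p0] := leP (fine (P A)) 0; first exact: le_trans p0 (expR_ge0 _).
rewrite -[X in X <= _]lnK ?posrE // ler_expR.
apply/ler_addgt0Pr => e e0.
have sl : 0 <= s%:R * lam by rewrite mulr_ge0.
have sl1 : 0 < s%:R * lam + 1 by rewrite ltr_pwDr.
have xi0 : 0 < e / (s%:R * lam + 1) by rewrite divr_gt0.
have := hoeffding_discretized t iid mg gb lam0 lamr xi0.
rewrite -/mu -/A PA lee_fin -[X in X <= _]lnK ?posrE // ler_expR.
move/le_trans; apply.
have -> : s%:R * (lam * (e / (s%:R * lam + 1) - t) + lam ^+ 2 * r ^+ 2)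
   = s%:R * lam * e / (s%:R * lam + 1) - s%:R * (lam * t - lam ^+ 2 * r ^+ 2).
  by field; rewrite gt_eqF.
rewrite addrC; apply: lerD; last first.
  by rewrite ler_pdivrMr // [leRHS]mulrC ler_wpM2r ?(ltW e0) // lerDl.
rewrite le_eqVlt; apply/orP; left; apply/eqP; rewrite /lam; field.
by rewrite gt_eqF.
Qed.

(** The empirical mean minus the expectation, multiplied by the sample size so
    that no division is involved. *)
Definition deviation d (T : measurableType d) (R : realType)
    (tau : probability T R) (s : nat) (D : 'I_s -> T) (g : T -> R) : R :=
  `|\sum_j g (D j) - s%:R * \int[tau]_x g x|.

Lemma measurable_deviation d d' (T : measurableType d) (Om : measurableType d')
    (R : realType) (tau : probability T R) (P : probability Om R) (s : nat)
    (S : 'I_s -> {RV P >-> T}) (g : T -> R) (t : R) :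
  measurable_fun setT g ->
  measurable [set w | t <= deviation tau (S ^~ w) g].
Proof.
move=> mg.
rewrite [X in measurable X](_ : _ =
    (fun w => deviation tau (S ^~ w) g) @^-1` `[t, +oo[); last first.
  by apply/seteqP; split => w /=; rewrite in_itv /= andbT.
rewrite -[X in measurable X]setTI.
suff : measurable_fun setT (fun w => deviation tau (S ^~ w) g) by apply.
apply: measurableT_comp => //; apply: measurable_funD => //.
apply: (@measurable_sum _ _ _ _ _ _ (fun j w => g (S j w))) => // j.
exact: measurableT_comp.
Qed.

Lemma hoeffding_two_sided d d' (T : measurableType d) (Om : measurableType d')
    (R : realType) (tau : probability T R) (P : probability Om R) (s : nat)
    (S : 'I_s -> {RV P >-> T}) (g : T -> R) (lo r t : R) :
  iid_sample tau S -> measurable_fun setT g ->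
  (forall x, lo <= g x <= lo + r) -> 0 < r -> 0 <= t <= 2 / 3 * r ->
  (P [set w | (s%:R * t <= deviation tau (S ^~ w) g)%R]
   <= (2 * expR (- (s%:R * t ^+ 2 / (4 * r ^+ 2)))%R)%:E)%E.
Proof.
move=> iid mg gb r0 tr.
have mNg : measurable_fun setT (fun x => - g x) by exact: measurable_funN.
have Ngb x : - (lo + r) <= - g x <= - (lo + r) + r.
  by have := gb x; lra.
have up := hoeffding iid mg gb r0 tr.
have dn := hoeffding iid mNg Ngb r0 tr.
rewrite mulr2n mulrDl mul1r EFinD.
apply: le_trans (leeD up dn).
have mup := measurable_sample_sum_ge S (s%:R * (\int[tau]_x g x + t)) mg.
have mdn := measurable_sample_sum_ge S (s%:R * (\int[tau]_x (- g x) + t)) mNg.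
apply: le_trans (measureU2 P mup mdn).
apply: le_measure; rewrite ?inE.
- exact: measurable_deviation.
- exact: measurableU mup mdn.
have ig : tau.-integrable setT (EFin \o g).
  apply: (@bounded_integrable _ _ _ _ _ (`|lo| + r)) => // x.
  have /andP[g1 g2] := gb x.
  rewrite ler_norml; have := ler_norm (- lo); have := ler_norm lo.
  by rewrite normrN; lra.
have -> : \int[tau]_x - g x = - \int[tau]_x g x.
  under eq_Rintegral do rewrite -mulN1r.
  by rewrite RintegralZl // mulN1r.
move=> w /=; rewrite /deviation ler_normr => /orP[h|h]; [left|right].
  by lra.
by rewrite sumrN; lra.
Qed.

Lemma deviationD d (T : measurableType d) (R : realType)
    (tau : probability T R) (s : nat) (D : 'I_s -> T) (g h : T -> R) :
  tau.-integrable setT (EFin \o g) -> tau.-integrable setT (EFin \o h) ->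
  deviation tau D (fun x => g x + h x) <= deviation tau D g + deviation tau D h.
Proof.
move=> ig ih; rewrite /deviation RintegralD // big_split /= mulrDr opprD addrACA.
exact: ler_normD.
Qed.

Lemma deviation_le d (T : measurableType d) (R : realType)
    (tau : probability T R) (s : nat) (D : 'I_s -> T) (g : T -> R) (e : R) :
  measurable_fun setT g -> (forall x, `|g x| <= e) ->
  deviation tau D g <= s%:R * (2 * e).
Proof.
move=> mg ge; have ig := bounded_integrable tau mg ge.
rewrite /deviation (_ : s%:R * (2 * e) = s%:R * e + s%:R * e); last by ring.
apply: le_trans (ler_normB _ _) _; apply: lerD.
  apply: le_trans (ler_norm_sum _ _ _) _.
  by rewrite mulr_natl -[X in _ *+ X](card_ord s) -sumr_const ler_sum.
rewrite normrM ger0_norm // ler_wpM2l //.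
apply: le_trans (le_normr_Rintegral _ ig) _ => //.
rewrite -[leRHS](Rintegral_prob_cst tau e); apply: le_Rintegral => //.
- by apply: (@bounded_integrable _ _ _ _ _ e) => [|x];
    [exact: measurableT_comp|rewrite normr_id].
- exact: finite_measure_integrable_cst.
Qed.

(** * Uniform deviations over a class with polynomial nets *)

Lemma inner_prob_ge d (T : measurableType d) (R : realType)
    (P : probability T R) (E A : set T) :
  measurable E -> E `<=` A -> (P E <= inner_prob P A)%E.
Proof. by move=> mE EA; apply: ereal_sup_ubound; exists E. Qed.

(** The arithmetic of the union bound, with X the target exponential and
    B = delta^-c2. The coarse net has N points, a number that does not depend on
    delta, and each costs 2 X. The fine net has m^D points with m of order
    1 / delta, and each costs 2 X^(q+1). When the claimed bound is nontrivial,
    X <= 1 / B, and the extra power X^q <= B^-q <= delta^D pays for the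
    cardinality of the fine net. *)
Lemma two_scale_count (R : realType) (delta c2 X lc : R) (N m q D : nat) :
  0 < delta <= 1 -> 0 < c2 -> 0 < X -> 0 <= lc ->
  delta^-1 `^ c2 * X <= 1 -> D%:R <= c2 * q%:R -> m%:R <= lc / delta ->
  2 * N%:R + 2 * lc ^+ D <= delta^-1 `^ c2 ->
  N%:R * (2 * X) + (m ^ D)%:R * (2 * X ^+ q.+1) <= delta^-1 `^ c2 * X.
Proof.
move=> /andP[d0 d1] c20 X0 lc0 BX Dq ml NB.
set B := delta^-1 `^ c2 in BX NB *.
have dV : 1 <= delta^-1 by rewrite invf_ge1.
have B0 : 0 < B by rewrite powR_gt0 // invr_gt0.
have XB : X ^+ q <= B^-1 ^+ q.
  rewrite lerXn2r ?nnegrE ?invr_ge0 ?(ltW X0) ?(ltW B0) //.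
  by rewrite -[leRHS]mul1r ler_pdivlMr // mulrC.
have Bq : delta^-1 ^+ D <= B ^+ q.
  rewrite -(powR_mulrn D (le_trans ler01 dV)) -(powR_mulrn q (ltW B0)).
  by rewrite /B -powRrM ler_powR.
have mq : (m ^ D)%:R * X ^+ q <= lc ^+ D.
  apply: (@le_trans _ _ ((lc * delta^-1) ^+ D * B^-1 ^+ q)).
    by apply: ler_pM => //; rewrite ?natrX ?exprn_ge0 ?lerXn2r ?nnegrE ?(ltW X0)
      ?mulr_ge0 ?invr_ge0 ?(ltW d0).
  rewrite exprMn -mulrA exprVn -[leRHS]mulr1 ler_wpM2l ?exprn_ge0 //.
  by rewrite ler_pdivrMr ?exprn_gt0 // mul1r.
apply: (@le_trans _ _ ((2 * N%:R + 2 * lc ^+ D) * X)); last by rewrite ler_pM2r.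
have -> : N%:R * (2 * X) + (m ^ D)%:R * (2 * X ^+ q.+1)
   = (2 * N%:R + 2 * ((m ^ D)%:R * X ^+ q)) * X by rewrite exprS; ring.
by rewrite ler_pM2r // lerD2l ler_pM2l.
Qed.

(** Two-scale chaining. The deviation of g u is split along
    g u = (g u - fine) + (fine - coarse) + coarse, where fine and coarse are
    values of g at net points, and the budget 2 delta is split accordingly as
    1/4 + 1/4 + 3/2 times delta. The first term is bounded pointwise, because
    the fine net has mesh of order delta. The second one has a range of at most
    2 rho, so that Hoeffding's inequality gives it an exponent of order
    s delta^2 / rho^2; the coarse mesh rho is a constant chosen so small that
    this is at least q + 1 times the target exponent. The third one uses only the
    finitely many coarse points. *)
Lemma uniform_deviation d (T : measurableType d) (R : realType)
    (tau : probability T R) (U : Type) (K : set U) (g : U -> T -> R)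
    (I : finType) (r lc c2 : R) :
  0 < r -> 0 < lc -> 0 < c2 ->
  (forall u, K u -> measurable_fun setT (g u)) ->
  (forall u x, K u -> 0 <= g u x <= r) ->
  (forall m, (0 < m)%N -> exists net : {ffun I -> 'I_m} -> U,
     (forall v, K (net v)) /\
     forall u, K u -> exists v, forall x, `|g u x - g (net v) x| <= lc / m%:R) ->
  exists2 delta0 : R, 0 < delta0 &
  forall delta, 0 < delta <= delta0 ->
  forall s d' (Om : measurableType d') (P : probability Om R)
         (S : 'I_s -> {RV P >-> T}),
    iid_sample tau S ->
    ((1 - delta^-1 `^ c2 * expR (- (32 / 81 * s%:R * delta ^+ 2 / r ^+ 2)))%:E
     <= inner_prob P
          [set w | forall u, K u -> (deviation tau (S ^~ w) (g u)
                                     <= s%:R * (2 * delta))%R])%E.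
Proof.
move=> r0 lc0 c20 mg gr nets.
(* The multiple q is chosen with D <= q c2, where D = #|I|, and the coarse mesh
   rho so that s (delta / 4)^2 / (4 (2 rho)^2) >= (q + 1) s delta^2 / r^2. *)
pose q := (Num.truncn (#|I|%:R / c2)).+1.
have Dq : #|I|%:R <= c2 * q%:R.
  rewrite mulrC -ler_pdivrMr // ltW //.
  by have /truncn_itv/andP[] : 0 <= #|I|%:R / c2 by rewrite divr_ge0 // ltW.
pose m1 := (Num.truncn (16 * q.+1%:R * lc / r)).+1.
pose rho := lc / m1%:R.
have rho0 : 0 < rho by rewrite divr_gt0.
have rhor : 16 * q.+1%:R * rho <= r.
  rewrite mulrA ler_pdivrMr // -ler_pdivrMl // mulrC ltW //.
  have /truncn_itv/andP[] // : 0 <= 16 * q.+1%:R * lc / r.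
  by rewrite divr_ge0 ?mulr_ge0 // ltW.
have rhor2 : q.+1%:R * (16 * rho) ^+ 2 <= r ^+ 2.
  have q1 : 1 <= q.+1%:R :> R by rewrite ler1n.
  have rho16 : 0 <= 16 * rho by rewrite mulr_ge0 // ltW.
  have qrho : q.+1%:R * (16 * rho) <= r by rewrite mulrCA mulrA.
  apply: (@le_trans _ _ ((q.+1%:R * (16 * rho)) ^+ 2)).
    by rewrite [leRHS]exprMn ler_wpM2r ?sqr_ge0 // ler_eXnr.
  by rewrite lerXn2r // nnegrE ?mulr_ge0 // ltW.
have [net1 [Knet1 net1P]] := nets m1 isT.
pose N := (m1 ^ #|I|)%N.
pose Kc := 2 * N%:R + 2 * (8 * lc + 1) ^+ #|I|.
have lc1 : 0 < 8 * lc + 1 by lra.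
have Kc0 : 0 < Kc.
  by rewrite ltr_wpDl ?mulr_ge0 // mulr_gt0 // exprn_gt0.
(* The last bound on delta says that delta^-c2 exceeds Kc. *)
pose delta0 := Num.min (Num.min 1 (r / 3)) (Num.min rho (Kc `^ c2^-1)^-1).
exists delta0.
  by rewrite !lt_min ltr01 divr_gt0 //= rho0 invr_gt0 powR_gt0.
move=> delta /andP[d0]; rewrite !le_min => /andP[/andP[d1 dr] /andP[drho dK]].
move=> s d' Om P S iid.
set X := expR _; set B := delta^-1 `^ c2.
have KB : Kc <= B.
  rewrite -[Kc]powRr1 ?(ltW Kc0) // -(mulVf (lt0r_neq0 c20)) powRrM.
  rewrite ge0_ler_powR ?nnegrE ?powR_ge0 ?invr_ge0 ?(ltW c20) ?(ltW d0) //.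
  by rewrite -[leLHS]invrK lef_pV2 ?posrE ?invr_gt0 ?powR_gt0.
have [BX|BX] := leP 1 (B * X).
  apply: le_trans (inner_prob_ge (E := set0) _ _ _) => //.
  by rewrite measure0 lee_fin subr_le0.
(* Fine mesh at most delta / 8: it counts twice, in the mean and in the law. *)
pose m2 := (Num.truncn (8 * lc / delta)).+1.
have m2l : m2%:R <= (8 * lc + 1) / delta.
  have tr : (Num.truncn (8 * lc / delta))%:R <= 8 * lc / delta.
    by rewrite truncn_le divr_ge0 ?mulr_ge0 // ltW.
  have -> : m2%:R = (Num.truncn (8 * lc / delta))%:R + 1 :> R by rewrite natr1.
  by rewrite (mulrDl (8 * lc) 1) lerD // mul1r invf_ge1.
have m2d : lc / m2%:R <= delta / 8.
  have /truncn_itv/andP[_ lt_m2] : 0 <= 8 * lc / delta.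
    by rewrite divr_ge0 ?mulr_ge0 // ltW.
  rewrite ler_pdivrMr // mulrAC ler_pdivlMr // mulrC.
  by rewrite [leRHS]mulrC -ler_pdivrMr // ltW.
have [net2 [Knet2 net2P]] := nets m2 isT.
have [pi piP] : exists pi : {ffun I -> 'I_m2} -> {ffun I -> 'I_m1},
    forall v x, `|g (net2 v) x - g (net1 (pi v)) x| <= rho.
  have /choice[pi piP] : forall v, exists v',
      forall x, `|g (net2 v) x - g (net1 v') x| <= rho.
    by move=> v; exact: net1P.
  by exists pi.
pose h v x := g (net2 v) x - g (net1 (pi v)) x.
have mh v : measurable_fun setT (h v).
  by apply: measurable_funB; exact: mg.
pose bad1 (v : {ffun I -> 'I_m1}) : set Om :=
  [set w | s%:R * (3 / 2 * delta) <= deviation tau (S ^~ w) (g (net1 v))].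
pose bad2 (v : {ffun I -> 'I_m2}) : set Om :=
  [set w | s%:R * (delta / 4) <= deviation tau (S ^~ w) (h v)].
have sd0 : 0 <= s%:R * delta ^+ 2 by apply: mulr_ge0 => //; exact: sqr_ge0.
have Pbad1 v : (P (bad1 v) <= (2 * X)%:E)%E.
  apply: (le_trans (hoeffding_two_sided (lo := 0) (r := r) iid _ _ _ _)) => //.
  - exact: mg.
  - by move=> x; rewrite add0r; exact: gr.
  - by apply/andP; split; lra.
  rewrite lee_fin ler_pM2l // ler_expR lerN2 exprMn.
  have -> : s%:R * ((3 / 2) ^+ 2 * delta ^+ 2) / (4 * r ^+ 2)
      = 9 / 16 * (s%:R * delta ^+ 2 / r ^+ 2) by field; rewrite gt_eqF.
  have -> : 32 / 81 * s%:R * delta ^+ 2 / r ^+ 2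
      = 32 / 81 * (s%:R * delta ^+ 2 / r ^+ 2) by rewrite !mulrA.
  apply: ler_wpM2r; last by lra.
  by rewrite divr_ge0 // sqr_ge0.
have Pbad2 v : (P (bad2 v) <= (2 * X ^+ q.+1)%:E)%E.
  apply: (le_trans (hoeffding_two_sided (lo := - rho) (r := 2 * rho)
    iid _ _ _ _)) => //.
  - by move=> x; have := piP v x; rewrite ler_norml -/(h v x); lra.
  - lra.
  - by apply/andP; split; lra.
  rewrite lee_fin ler_pM2l // -expRM_natl ler_expR mulrN lerN2.
  have rho2 : 0 < (16 * rho) ^+ 2 by rewrite exprn_gt0 // mulr_gt0.
  have r2 : 0 < r ^+ 2 by exact: exprn_gt0.
  have -> : s%:R * (delta / 4) ^+ 2 / (4 * (2 * rho) ^+ 2)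
      = s%:R * delta ^+ 2 * ((16 * rho) ^+ 2)^-1.
    by field; rewrite gt_eqF.
  apply: (@le_trans _ _ (q.+1%:R * (s%:R * delta ^+ 2 / r ^+ 2))).
    have -> : 32 / 81 * s%:R * delta ^+ 2 / r ^+ 2
        = 32 / 81 * (s%:R * delta ^+ 2 / r ^+ 2) by rewrite !mulrA.
    by rewrite ler_wpM2l // ler_piMl ?divr_ge0 ?(ltW r2) //; lra.
  rewrite mulrCA ler_wpM2l // ler_pdivrMr // mulrC ler_pdivlMr //.
pose bad : set Om := (\big[setU/set0]_(i : {ffun I -> 'I_m1}) bad1 i)
  `|` (\big[setU/set0]_(i : {ffun I -> 'I_m2}) bad2 i).
have mbad1 i : measurable (bad1 i).
  by apply: measurable_deviation; exact: mg.
have mbad2 i : measurable (bad2 i).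
  exact: measurable_deviation.
have mbad : measurable bad.
  by apply: measurableU; exact: bigsetU_measurable.
have Pbad : (P bad <= (B * X)%:E)%E.
  apply: (@le_trans _ _ (\sum_v P (bad1 v) + \sum_v P (bad2 v))%E).
    apply: le_trans (measureU2 P _ _) _; [exact: bigsetU_measurable..|].
    apply: leeD; apply: measure_le_sum; [exact: bigsetU_measurable|by[]| |
                                        exact: bigsetU_measurable|by[]|].
      by move=> w; rewrite -bigcup_seq => -[i _ ?]; exists i.
    by move=> w; rewrite -bigcup_seq => -[i _ ?]; exists i.
  apply: (@le_trans _ _ (\sum_(v : {ffun I -> 'I_m1}) (2 * X)%:E
      + \sum_(v : {ffun I -> 'I_m2}) (2 * X ^+ q.+1)%:E)%E).
    apply: leeD; apply: lee_sum => i _; [exact: Pbad1|exact: Pbad2].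
  rewrite !sumEFin -EFinD lee_fin !sumr_const !card_ffun !card_ord.
  rewrite -[X in X + _]mulr_natl -[X in _ + X]mulr_natl.
  apply: (two_scale_count (lc := 8 * lc + 1)) => //; rewrite ?expR_gt0 ?d0 ?d1 //.
  - exact: ltW.
  - exact: ltW.
apply: le_trans (inner_prob_ge (E := ~` bad) _ _ _); first last.
- move=> w nbad u Ku.
  have nb1 v : deviation tau (S ^~ w) (g (net1 v)) <= s%:R * (3 / 2 * delta).
    rewrite leNgt; apply/negP => /ltW b1; apply: nbad; left.
    by rewrite -bigcup_seq; exists v => //=; rewrite mem_index_enum.
  have nb2 v : deviation tau (S ^~ w) (h v) <= s%:R * (delta / 4).
    rewrite leNgt; apply/negP => /ltW b2; apply: nbad; right.
    by rewrite -bigcup_seq; exists v => //=; rewrite mem_index_enum.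
  have gint u' : K u' -> tau.-integrable setT (EFin \o g u').
    move=> Ku'; apply: (@bounded_integrable _ _ _ _ _ r) => [|x]; first exact: mg.
    by rewrite ger0_norm; case/andP: (gr u' x Ku').
  have [v uv] := net2P u Ku.
  pose k x := g u x - g (net2 v) x.
  have mk : measurable_fun setT k by apply: measurable_funB; exact: mg.
  have ik := bounded_integrable tau mk uv.
  have ih := bounded_integrable tau (mh v) (piP v).
  have -> : g u = fun x => k x + (h v x + g (net1 (pi v)) x).
    by apply/funext => x; rewrite /k /h; ring.
  have ihg : tau.-integrable setT (EFin \o (fun x => h v x + g (net1 (pi v)) x)).
    rewrite (_ : (fun x => h v x + g (net1 (pi v)) x) = g (net2 v)).
      exact: gint.
    by apply/funext => x; rewrite /h; ring.
  apply: le_trans (deviationD _ ik ihg) _.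
  have dk := @deviation_le _ _ _ tau _ (S ^~ w) _ _ mk uv.
  have dh := deviationD (S ^~ w) ih (gint _ (Knet1 (pi v))).
  apply: le_trans (lerD dk (le_trans dh (lerD (nb2 v) (nb1 (pi v))))) _.
  rewrite -!mulrDr ler_wpM2l //.
  by move: m2d; lra.
- exact: measurableC.
rewrite probability_setC // EFinB.
by apply: leeB.
Qed.

(** * Regularity of the squared error in the parameters *)

(** Families g u x that are measurable in x and, for u in K and x in A,
    uniformly bounded and Lipschitz in u, where close e u u' reads as distance
    at most e. Bounds and Lipschitz constants are kept existential, so that the
    property passes through every operation of a network without bookkeeping;
    boundedness is what makes it stable under products. *)
Definition tame d (T : measurableType d) (R : realType) (U : Type) (K : set U)
    (close : R -> U -> U -> Prop) (A : set T) (g : U -> T -> R) : Prop :=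
  (forall u, measurable_fun setT (g u)) /\
  exists B lc : R,
    (forall u x, K u -> A x -> `|g u x| <= B) /\
    (forall u u' e x, K u -> K u' -> A x -> 0 <= e -> close e u u' ->
       `|g u x - g u' x| <= lc * e).

Section tame_closure.
Context d (T : measurableType d) (R : realType) (U : Type) (K : set U)
  (close : R -> U -> U -> Prop) (A : set T).
Local Notation tame := (tame K close A).
Implicit Types g h : U -> T -> R.

Lemma tame_ext g h : (forall u x, g u x = h u x) -> tame g -> tame h.
Proof.
by move=> gh; rewrite (_ : g = h) //; apply/funext => u; apply/funext => x.
Qed.

Lemma tame_cst (c : R) : tame (fun _ _ => c).
Proof.
split=> [u|]; first exact: measurable_cst.
by exists `|c|, 0; split => // *; rewrite subrr normr0 mul0r.
Qed.

Lemma tame_add g h : tame g -> tame h -> tame (fun u x => g u x + h u x).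
Proof.
move=> [mg [B [lc [gB gl]]]] [mh [B' [lc' [hB hl]]]]; split=> [u|].
  exact: measurable_funD.
exists (B + B'), (lc + lc'); split => [u x Ku Ax|u u' e x Ku Ku' Ax e0 ee].
  by apply: le_trans (ler_normD _ _) _; rewrite lerD ?gB ?hB.
rewrite opprD addrACA mulrDl.
by apply: le_trans (ler_normD _ _) _; rewrite lerD ?gl ?hl.
Qed.

Lemma tame_mul g h : tame g -> tame h -> tame (fun u x => g u x * h u x).
Proof.
move=> [mg [B [lc [gB gl]]]] [mh [B' [lc' [hB hl]]]]; split=> [u|].
  exact: measurable_funM.
exists (B * B'), (B * lc' + B' * lc).
split => [u x Ku Ax|u u' e x Ku Ku' Ax e0 ee].
  by rewrite normrM ler_pM ?gB ?hB.
rewrite (_ : _ - _ = g u x * (h u x - h u' x) + h u' x * (g u x - g u' x));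
  last by ring.
apply: le_trans (ler_normD _ _) _; rewrite !normrM mulrDl -!mulrA.
by apply: lerD; apply: ler_pM; rewrite ?gB ?hB ?gl ?hl.
Qed.

Lemma tame_abs g : tame g -> tame (fun u x => `|g u x|).
Proof.
move=> [mg [B [lc [gB gl]]]]; split=> [u|].
  exact: measurableT_comp.
exists B, lc; split => [u x Ku Ax|u u' e x Ku Ku' Ax e0 ee].
  by rewrite normr_id gB.
exact: le_trans (ler_dist_dist _ _) (gl _ _ _ _ Ku Ku' Ax e0 ee).
Qed.

Lemma tame_sub g h : tame g -> tame h -> tame (fun u x => g u x - h u x).
Proof.
move=> tg th; apply: (tame_ext (g := fun u x => g u x + (-1) * h u x)).
  by move=> u x; rewrite mulN1r.
by apply: tame_add => //; apply: tame_mul => //; exact: tame_cst.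
Qed.

Lemma tame_max g h : tame g -> tame h -> tame (fun u x => Num.max (g u x) (h u x)).
Proof.
move=> tg th.
apply: (tame_ext (g := fun u x => (g u x + h u x + `|g u x - h u x|) * 2^-1)).
  by move=> u x; rewrite maxr_absE.
apply: tame_mul (tame_cst _); apply: tame_add; first exact: tame_add.
by apply: tame_abs; exact: tame_sub.
Qed.

Lemma tame_min g h : tame g -> tame h -> tame (fun u x => Num.min (g u x) (h u x)).
Proof.
move=> tg th.
apply: (tame_ext (g := fun u x => (g u x + h u x - `|g u x - h u x|) * 2^-1)).
  by move=> u x; rewrite minr_absE.
apply: tame_mul (tame_cst _); apply: tame_sub; first exact: tame_add.
by apply: tame_abs; exact: tame_sub.
Qed.

Lemma tame_sum (I : Type) (l : seq I) (g : I -> U -> T -> R) :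
  (forall i, tame (g i)) -> tame (fun u x => \sum_(i <- l) g i u x).
Proof.
move=> tg; elim: l => [|i l IH].
  by apply: tame_ext (tame_cst 0) => u x; rewrite big_nil.
by apply: tame_ext (tame_add (tg i) IH) => u x; rewrite big_cons.
Qed.

End tame_closure.

Definition param_box (R : realType) (n L : nat) : set (param R n L) :=
  [set th : param R n L | forall k i, `|th k i 0| <= 1].

Definition param_close (R : realType) (n L : nat) (e : R)
    (th th' : param R n L) : Prop :=
  forall k i, `|th k i 0 - th' k i 0| <= e.

(** The region that carries the law of the data. The constraint on the matrix is
    on its entries rather than on its operator norm, which makes the region
    visibly measurable. *)
Definition data_box (R : realType) (n : nat) (c : R) :
    set ('M[R]_n * 'cV[R]_n) :=
  [set D : 'M[R]_n * 'cV[R]_n | (forall i j, `|D.1 i j| <= 1) /\ enorm D.2 <= c].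

Lemma measurable_mx_entry (R : realType) (m n : nat) (i : 'I_m) (j : 'I_n) :
  measurable_fun setT (fun A : 'M[R]_(m, n) => A i j).
Proof.
move=> _ Y mY; apply: sub_sigma_algebra; exists (i, j) => //.
by exists Y.
Qed.

Lemma enorm_ge0 (R : realType) (n : nat) (v : 'cV[R]_n) : 0 <= enorm v.
Proof. exact: sqrtr_ge0. Qed.

Lemma sqr_enorm (R : realType) (n : nat) (v : 'cV[R]_n) :
  enorm v ^+ 2 = \sum_i v i 0 ^+ 2.
Proof. by rewrite sqr_sqrtr // sumr_ge0 // => i _; exact: sqr_ge0. Qed.

Lemma entry_le_enorm (R : realType) (n : nat) (v : 'cV[R]_n) i :
  `|v i 0| <= enorm v.
Proof.
rewrite -(ler_pXn2r (n := 2)) ?nnegrE ?enorm_ge0 // sqr_enorm real_normK ?num_real //.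
by rewrite (bigD1 i) //= lerDl sumr_ge0 // => j _; exact: sqr_ge0.
Qed.

Section tame_network.
Context (R : realType) (n L : nat) (a : architecture R n L) (c : R).
Local Notation data := ('M[R]_n * 'cV[R]_n)%type.
Local Notation tame :=
  (@tame _ data R (param R n L) (@param_box R n L) (@param_close R n L)
     (data_box c)).

Lemma tame_param k i : tame (fun (th : param R n L) _ => th k i 0).
Proof.
split=> [th|]; first exact: measurable_cst.
by exists 1, 1; split => [th D|th th' e D _ _ _ _ cl];
  [move=> + _; exact|rewrite mul1r].
Qed.

Lemma tame_data1 i j : tame (fun _ (D : data) => D.1 i j).
Proof.
split=> [th|].
  exact: measurableT_comp (measurable_mx_entry i j) measurable_fst.
exists 1, 0; split => [th D _ []//|th th' e D _ _ _ e0 _].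
by rewrite subrr normr0 mul0r.
Qed.

Lemma tame_data2 i : tame (fun _ (D : data) => D.2 i 0).
Proof.
split=> [th|].
  exact: measurableT_comp (measurable_mx_entry i 0) measurable_snd.
exists c, 0; split => [th D _ [_]|th th' e D _ _ _ e0 _].
  exact: le_trans (entry_le_enorm _ _).
by rewrite subrr normr0 mul0r.
Qed.

Definition tame_mx p q (h : param R n L -> data -> 'M[R]_(p, q)) :=
  forall i j, tame (fun th D => h th D i j).

Lemma tame_mx_add p q (g h : param R n L -> data -> 'M[R]_(p, q)) :
  tame_mx g -> tame_mx h -> tame_mx (fun th D => g th D + h th D).
Proof.
by move=> tg th i j; apply: tame_ext (tame_add (tg i j) (th i j)) => u D;
  rewrite mxE.
Qed.

Lemma tame_mx_mul p q r (g : param R n L -> data -> 'M[R]_(p, q))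
    (h : param R n L -> data -> 'M[R]_(q, r)) :
  tame_mx g -> tame_mx h -> tame_mx (fun th D => g th D *m h th D).
Proof.
move=> tg th i j; apply: tame_ext (tame_sum (index_enum 'I_q)
  (fun k => tame_mul (tg i k) (th k j))) => u D.
by rewrite mxE.
Qed.

Lemma tame_mx_sum p q (I : Type) (l : seq I)
    (g : I -> param R n L -> data -> 'M[R]_(p, q)) :
  (forall i, tame_mx (g i)) -> tame_mx (fun th D => \sum_(i <- l) g i th D).
Proof.
move=> tg i j; apply: tame_ext (tame_sum l (fun k => tg k i j)) => u D.
by rewrite summxE.
Qed.

Lemma tame_mx_cst p q (M : 'M[R]_(p, q)) : tame_mx (fun _ _ => M).
Proof. by move=> i j; exact: tame_cst. Qed.

Lemma tame_mx_param k : tame_mx (fun (th : param R n L) _ => th k).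
Proof. by move=> i j; rewrite ord1; exact: tame_param. Qed.

Lemma tame_rank_one l i p : tame_mx (fun th _ => rank_one th l i p).
Proof.
apply: tame_mx_mul; first exact: tame_mx_param.
move=> q k; apply: tame_ext (tame_mx_param _ k q) => u D.
by rewrite mxE.
Qed.

Lemma tame_affine_part l i (h : param R n L -> data -> 'cV[R]_n) :
  tame_mx h -> tame_mx (fun th D => affine_part a th D.1 l i (h th D)).
Proof.
have tlin M r : tame_mx (fun th _ => M + \sum_(p <- r) rank_one th l i p).
  apply: tame_mx_add; first exact: tame_mx_cst.
  by apply: tame_mx_sum => p; exact: tame_rank_one.
move=> th; apply: tame_mx_add; first apply: tame_mx_add.
- exact: tame_mx_param.
- by apply: tame_mx_mul => //; exact: tlin.
- apply: tame_mx_mul; first exact: tlin.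
  by apply: tame_mx_mul => // p q; exact: tame_data1.
Qed.

(** Induction over the layers, for an arbitrary tame input vector. *)
Lemma tame_network : tame_mx (fun th D => network a th D.1).
Proof.
suff fold r h : tame_mx h ->
    tame_mx (fun th D => foldl (layer a th D.1) (h th D) r).
  by apply: (fold _ (fun _ _ => net_h0 a)); exact: tame_mx_cst.
elim: r h => [//|l r IH] h th /=.
apply: (IH (fun th D => layer a th D.1 (h th D) l)).
apply: tame_mx_add; first exact: tame_affine_part.
move=> i j; apply: tame_ext (tame_max (tame_affine_part l ord_max th i 0)
  (tame_mul (tame_cst _ _ _ (net_eta a l))
            (tame_affine_part l ord_max th i 0))) => u D.
by rewrite [RHS]mxE.
Qed.

Lemma tame_sq_error : tame (sq_error a c).
Proof.
have tdiff i : tame (fun th D => (truncated_network a c th D.1 - D.2) i 0).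
  have tc := tame_cst (@param_box R n L) (@param_close R n L) (@data_box R n c).
  apply: tame_ext (tame_sub (tame_max (tc (- c))
    (tame_min (tame_network i 0) (tc c))) (tame_data2 i)) => u D.
  by rewrite [RHS]mxE [in RHS]mxE [X in _ = _ + X]mxE.
apply: tame_ext (tame_sum (index_enum 'I_n)
  (fun i => tame_mul (tdiff i) (tdiff i))) => u D.
by rewrite /sq_error sqr_enorm; apply: eq_bigr => i _; rewrite expr2.
Qed.

End tame_network.

(** * Nets and bounds for the squared error *)

Lemma unit_interval_net (R : realType) (m : nat) (x : R) :
  (0 < m)%N -> `|x| <= 1 ->
  exists j : 'I_m, `|x - (2 * j%:R / m%:R - 1)| <= 2 / m%:R.
Proof.
case: m => // m _; rewrite ler_norml => /andP[x1 x2].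
pose t := (x + 1) / 2 * m.+1%:R.
have t0 : 0 <= t by rewrite mulr_ge0 //; lra.
have tm : t <= m.+1%:R by rewrite ler_piMl //; lra.
have m0 : 0 < m.+1%:R :> R by [].
have -> : x = 2 * t / m.+1%:R - 1 by rewrite /t; field; rewrite lt0r_neq0.
suff [j jt] : exists j : 'I_m.+1, `|t - j%:R| <= 1.
  exists j; rewrite [X in `|X|](_ : _ = 2 * (t - j%:R) / m.+1%:R); last first.
    by field; rewrite lt0r_neq0.
  rewrite normrM normfV normrM !normr_nat ler_pM2r ?invr_gt0 //.
  by rewrite ler_piMr.
have [tlt|tge] := ltP t m.+1%:R.
  have /andP[a b] := truncn_itv t0.
  have jm : (Num.truncn t < m.+1)%N by rewrite truncn_lt_nat.
  exists (Ordinal jm) => /=; rewrite ler_norml; move: b; rewrite -natr1; lra.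
exists ord_max => /=; rewrite ler_norml; move: tge tm; rewrite -natr1; lra.
Qed.

(** A grid in every coordinate: m^D points for D coordinates, and mesh 2 / m. *)
Lemma param_box_net (R : realType) (n L m : nat) : (0 < m)%N ->
  exists net : {ffun param_index n L * 'I_n -> 'I_m} -> param R n L,
    (forall v, param_box (net v)) /\
    forall th, param_box th -> exists v, param_close (2 / m%:R) th (net v).
Proof.
move=> m0; have mR : 0 < m%:R :> R by rewrite ltr0n.
exists (fun v : {ffun param_index n L * 'I_n -> 'I_m} =>
  [ffun k : param_index n L => \col_(i < n) (2 * (v (k, i))%:R / m%:R - 1)]); split.
  move=> v k i; rewrite ffunE mxE ler_norml.
  have : 0 <= 2 * (v (k, i))%:R / m%:R :> R by rewrite divr_ge0 ?mulr_ge0 // ltW.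
  have : 2 * (v (k, i))%:R / m%:R <= 2 :> R.
    by rewrite ler_pdivrMr // ler_pM2l // ler_nat ltnW.
  lra.
move=> th box.
have /choice[v vP] : forall ki : param_index n L * 'I_n, exists j : 'I_m,
    `|th ki.1 ki.2 0 - (2 * j%:R / m%:R - 1)| <= 2 / m%:R.
  by move=> ki; exact: unit_interval_net.
exists [ffun ki => v ki] => k i; rewrite !ffunE mxE ffunE.
exact: vP (k, i).
Qed.

(** Each of the n squared differences is at most 2 c^2 + 2 y_i^2, and the y_i^2
    sum to at most c^2 <= n c^2. *)
Lemma sq_error_bound (R : realType) (n L : nat) (a : architecture R n L) (c : R)
    (th : param R n L) (D : 'M[R]_n * 'cV[R]_n) :
  (0 < n)%N -> 0 <= c -> data_box c D ->
  0 <= sq_error a c th D <= 4 * n%:R * c ^+ 2.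
Proof.
move=> n0 c0 [_ Dc]; rewrite exprn_ge0 ?enorm_ge0 //= /sq_error sqr_enorm.
set h := truncated_network _ _ _ _.
have hc i : `|h i 0| <= c.
  rewrite mxE ler_norml le_max lexx ge_max /=.
  by apply/andP; split; [lra|rewrite ge_min lexx orbT].
apply: (@le_trans _ _ (\sum_i (2 * c ^+ 2 + 2 * D.2 i 0 ^+ 2))).
  apply: ler_sum => i _; rewrite mxE [(- D.2) i 0]mxE.
  have : h i 0 ^+ 2 <= c ^+ 2.
    by rewrite -[leLHS]real_normK ?num_real // lerXn2r // nnegrE.
  have := sqr_ge0 (h i 0 + D.2 i 0).
  rewrite sqrrB sqrrD; move: (h i 0 ^+ 2) (D.2 i 0 ^+ 2) (h i 0 * D.2 i 0) => p q r.
  lra.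
rewrite big_split /= sumr_const card_ord -mulr_sumr -sqr_enorm.
have : enorm D.2 ^+ 2 <= c ^+ 2 by rewrite lerXn2r // nnegrE enorm_ge0.
have n1 : 1 <= n%:R :> R by rewrite ler1n.
rewrite -[X in X + _ <= _]mulr_natl.
have : 2 * c ^+ 2 <= n%:R * (2 * c ^+ 2).
  by apply: ler_peMl => //; apply: mulr_ge0 => //; exact: sqr_ge0.
lra.
Qed.

Lemma measurable_data_box (R : realType) (n : nat) (c : R) :
  0 <= c -> measurable (@data_box R n c).
Proof.
move=> c0.
rewrite [X in measurable X](_ : _ =
  (\bigcap_(ij in [set: 'I_n * 'I_n])
     ((fun D : 'M[R]_n * 'cV[R]_n => D.1 ij.1 ij.2) @^-1` `[-1, 1])) `&`
  ((fun D : 'M[R]_n * 'cV[R]_n => \sum_i D.2 i 0 ^+ 2) @^-1` `]-oo, c ^+ 2]));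
  last first.
  apply/seteqP; split => D /=; rewrite in_itv /= -sqr_enorm.
    move=> [D1 D2]; split; last by rewrite lerXn2r // nnegrE ?enorm_ge0.
    by move=> [i j] _ /=; rewrite in_itv /= -ler_norml.
  move=> [D1 D2]; split; last first.
    by rewrite -(ler_pXn2r (n := 2)) ?nnegrE ?enorm_ge0.
  by move=> i j; have := D1 (i, j) I; rewrite /= in_itv /= -ler_norml.
apply: measurableI.
  apply: fin_bigcap_measurable => [|[i j] _ /=]; first exact: finite_finset.
  rewrite -[X in measurable X]setTI.
  by apply: (measurableT_comp (measurable_mx_entry i j) measurable_fst).
rewrite -[X in measurable X]setTI.
apply: (@measurable_sum _ _ _ _ _ _
  (fun i (D : 'M[R]_n * 'cV[R]_n) => D.2 i 0 ^+ 2)) => // i.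
apply: measurable_funX.
exact: measurableT_comp (measurable_mx_entry i 0) measurable_snd.
Qed.

Lemma Theta_param_box (R : realType) (n L : nat) (th : param R n L) :
  Theta th -> param_box th.
Proof. by move=> Tth k i; apply: le_trans (entry_le_enorm _ _) (Tth k). Qed.

(** An inclusion of events that holds only almost surely is still good enough
    for inner probabilities. *)
Lemma inner_prob_le_full d (T : measurableType d) (R : realType)
    (P : probability T R) (G A A' : set T) :
  measurable G -> P G = 1%E -> A `&` G `<=` A' ->
  (inner_prob P A <= inner_prob P A')%E.
Proof.
move=> mG PG AG; apply: ge_ereal_sup => _ [E [mE EA] <-].
apply: (@le_trans _ _ (P (E `&` G))); last first.
  apply: inner_prob_ge; first exact: measurableI.
  by move=> w [/EA Aw Gw]; apply: AG.
have PGC : P (~` G) = 0%E by rewrite probability_setC // PG subee.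
rewrite -[in leLHS](setIT E) -(setUv G) setIUr.
have mEG : measurable (E `&` ~` G) by apply: measurableI => //; exact: measurableC.
apply: le_trans (measureU2 P (measurableI _ _ mE mG) mEG) _.
rewrite [X in (_ + X)%E](_ : _ = 0%E) ?adde0 //; apply/eqP.
rewrite eq_le measure_ge0 andbT -PGC; apply: le_measure => //;
  rewrite inE //; exact: measurableC.
Qed.

(** * Tail bound for the generalization gap *)

(** The regularizer cancels in the gap, which is therefore the deviation of the
    squared error divided by s. The squared error may be replaced by 0 off the
    data box, where neither the sample nor the law lives. *)
Lemma generalization_gap_le (R : realType) (n L : nat) (a : architecture R n L)
    (c alpha delta : R) (tau : probability ('M[R]_n * 'cV[R]_n)%type R)
    (s : nat) (D : 'I_s -> 'M[R]_n * 'cV[R]_n)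
    (th : ('I_s -> 'M[R]_n * 'cV[R]_n) -> param R n L) :
  (0 < n)%N -> 0 <= c -> tau (@data_box R n c) = 1%E -> (0 < s)%N ->
  (forall j, data_box c (D j)) ->
  deviation tau D (sq_error a c (th D) \_ (data_box c)) <= s%:R * (2 * delta) ->
  (generalization_gap a c alpha tau th D <= (2 * delta)%:E)%E.
Proof.
move=> n0 c0 tau1 s0 boxD.
set u := th D; set g := _ \_ _ => dev.
have mbox := @measurable_data_box R n c c0.
have tauC : tau (~` data_box c) = 0%E by rewrite probability_setC // tau1 subee.
have msq : measurable_fun setT (sq_error a c u) by case: (tame_sq_error a c).
have mg : measurable_fun setT g.
  by apply/(measurable_restrictT _ mbox); exact: measurable_funTS.
have gb x : `|g x| <= 4 * n%:R * c ^+ 2.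
  rewrite /g patchE; case: ifPn => [|_]; last first.
    by rewrite normr0 !mulr_ge0 ?sqr_ge0.
  rewrite inE => /(sq_error_bound a u n0 c0) /andP[sq0 sqle].
  by rewrite ger0_norm.
have ig := bounded_integrable tau mg gb.
rewrite /generalization_gap.
have -> : expected_loss a c alpha tau u
    = (\int[tau]_x g x + alpha * regularizer u)%:E.
  rewrite /expected_loss unlock.
  transitivity (\int[tau]_x (g x + alpha * regularizer u)%:E)%E.
    apply: ae_eq_integral => //.
    - apply/measurable_EFinP; apply: measurable_funD => //; exact: measurable_cst.
    - apply/measurable_EFinP; apply: measurable_funD => //; exact: measurable_cst.
    exists (~` data_box c); split; first exact: measurableC.
      exact: tauC.
    move=> x nx bx; apply: nx => _.
    by rewrite /g patchE mem_set.
  have iga : tau.-integrable setT (EFin \o (fun x => g x + alpha * regularizer u)).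
    apply: (@bounded_integrable _ _ _ _ _
      (4 * n%:R * c ^+ 2 + `|alpha * regularizer u|)) => [|x].
      by apply: measurable_funD => //; exact: measurable_cst.
    by apply: le_trans (ler_normD _ _) _; rewrite lerD2r.
  rewrite -(fineK (integrable_fin_num measurableT iga)); congr EFin.
  rewrite -[LHS]/(\int[tau]_x (g x + alpha * regularizer u)).
  rewrite RintegralD //; last exact: finite_measure_integrable_cst.
  by rewrite (Rintegral_prob_cst tau (alpha * regularizer u)).
rewrite /empirical_loss -EFinB abse_EFin lee_fin.
have -> : \sum_(j < s) sq_error a c u (D j) = \sum_(j < s) g (D j).
  by apply: eq_bigr => j _; rewrite /g patchE mem_set.
have sR : 0 < s%:R :> R by rewrite ltr0n.
rewrite [X in `|X|](_ : _ =
    s%:R^-1 * (\sum_(j < s) g (D j) - s%:R * \int[tau]_x g x)); last first.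
  by field; rewrite lt0r_neq0.
by rewrite normrM gtr0_norm ?invr_gt0 // ler_pdivrMl.
Qed.

Lemma sample_in_full_set d d' (T : measurableType d) (Om : measurableType d')
    (R : realType) (tau : probability T R) (P : probability Om R) (s : nat)
    (S : 'I_s -> {RV P >-> T}) (A : set T) :
  iid_sample tau S -> measurable A -> tau A = 1%E ->
  measurable [set w | forall j, A (S j w)] /\ P [set w | forall j, A (S j w)] = 1%E.
Proof.
move=> [law _] mA tauA; set G := [set _ | _].
have mG : measurable G.
  rewrite [G](_ : _ = \bigcap_(j in [set: 'I_s]) (S j @^-1` A)).
    apply: fin_bigcap_measurable => [|j _]; first exact: finite_finset.
    exact: measurable_funPTI.
  by apply/seteqP; split => w /= h j; [move=> _; exact: h|exact: (h j I)].
split=> //.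
have PGC : P (~` G) = 0%E.
  apply/eqP; rewrite eq_le measure_ge0 andbT.
  apply: (@le_trans _ _ (\sum_(j < s) P (S j @^-1` (~` A)))%E).
    apply: measure_le_sum => [|j|w /=]; first exact: measurableC.
      by apply: measurable_funPTI; exact: measurableC.
    by move=> /existsNP[j nAj]; exists j.
  rewrite big1 // => j _; rewrite -[LHS]/(distribution P (S j) (~` A)).
  by rewrite law; [rewrite probability_setC // tauA subee|exact: measurableC].
by rewrite -[G]setCK probability_setC ?PGC ?sube0 //; exact: measurableC.
Qed.

(** When c > 0, the uniform deviation bound is applied to the squared error cut
    off outside the data box, whose range is r = 4 n c^2; then
    (32/81) / r^2 = 2 / ((9 n)^2 c^4). When c = 0, the coefficient of the
    exponent is 2 / 0 = 0, the exponential is 1, and the claimed lower bound on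
    the probability is at most 0. *)
Lemma gap_bound_supported (R : realType) (n L : nat) (a : architecture R n L)
    (c0 c alpha lr0 C1 C2 : R) (tau : probability ('M[R]_n * 'cV[R]_n)%type R) :
  (0 < n)%N -> 0 <= c -> tau (@data_box R n c) = 1%E -> 1 <= C1 -> 0 < C2 ->
  gap_bound a c0 c alpha lr0 tau C1 C2.
Proof.
move=> n0 c_ge0 tau1 C1_ge1 C2_gt0; rewrite /gap_bound.
have [c_gt0|c_le0] := ltP 0 c; last first.
  have c_eq0 : c = 0 by apply/eqP; rewrite eq_le c_le0.
  near=> delta => s s0 dS OmS PS S _ _ th _.
  apply: (@le_trans _ _ 0%E); last first.
    by apply: le_trans (inner_prob_ge PS measurable0 (@sub0set _ _));
      rewrite measure0.
  rewrite lee_fin subr_le0 c_eq0 expr0n /= mulr0 invr0 mulr0 !mul0r oppr0.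
  rewrite expR0 mulr1.
  have delta_gt0 : 0 < delta by near: delta; exact: nbhs_right_gt.
  have delta_le1 : delta <= 1 by near: delta; exact: nbhs_right_le.
  have dV : 1 <= delta^-1 by rewrite invf_ge1.
  by rewrite mulr_ege1 // -(powRr0 delta^-1) ler_powR // ltW.
have mbox := @measurable_data_box R n c c_ge0.
pose g u := sq_error a c u \_ (data_box c) : _ -> R.
have gin u x : data_box c x -> g u x = sq_error a c u x.
  by move=> Ax; rewrite /g patchE mem_set.
have gout u x : ~ data_box c x -> g u x = 0.
  by move=> nAx; rewrite /g patchE memNset.
pose r := 4 * n%:R * c ^+ 2.
have nR : 0 < n%:R :> R by rewrite ltr0n.
have r_gt0 : 0 < r by rewrite !mulr_gt0 // exprn_gt0.
have [msq [K [lc [_ lip]]]] := tame_sq_error (L := L) a c.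
pose lc' := 2 * `|lc| + 1.
have lc'_gt0 : 0 < lc' by rewrite ltr_wpDl // mulr_ge0.
have [|||delta0 d0 unif] := @uniform_deviation _ _ _ tau (param R n L)
  (@param_box R n L) g (param_index n L * 'I_n)%type r lc' C2
  r_gt0 lc'_gt0 C2_gt0.
- move=> u _; apply/(measurable_restrictT _ mbox).
  exact: measurable_funTS (msq u).
- move=> u x _; have [Ax|nAx] := pselect (data_box c x).
    by rewrite gin //; exact: sq_error_bound.
  by rewrite gout // lexx ltW.
- move=> m m0; have [net [Knet netP]] := param_box_net R n L m0.
  exists net; split=> // u Ku; have [v uv] := netP u Ku; exists v => x.
  have mR : 0 < m%:R :> R by rewrite ltr0n.
  have [Ax|nAx] := pselect (data_box c x); last first.
    by rewrite !gout // subrr normr0 divr_ge0 // ltW.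
  rewrite !gin //.
  have e0 : 0 <= 2 / m%:R :> R by rewrite divr_ge0 // ltW.
  apply: le_trans (lip _ _ _ _ Ku (Knet v) Ax e0 uv) _.
  rewrite mulrA ler_pM2r ?invr_gt0 // /lc' mulrC.
  by have := ler_norm lc; lra.
near=> delta => s s0 dS OmS PS S law ind th minth.
have iid : iid_sample tau S by split.
have [mG PG] := sample_in_full_set iid mbox tau1.
have dd : 0 < delta <= delta0.
  by apply/andP; split; near: delta; [exact: nbhs_right_gt|exact: nbhs_right_le].
apply: le_trans (le_trans (unif _ dd s _ _ _ _ iid) _).
  rewrite lee_fin lerD2l lerN2.
  have -> : 2 / ((9 * n%:R) ^+ 2 * c ^+ 4) * s%:R * delta ^+ 2
      = 32 / 81 * s%:R * delta ^+ 2 / r ^+ 2.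
    by rewrite /r; field; rewrite !lt0r_neq0.
  by rewrite ler_wpM2r ?expR_ge0 // ler_peMl ?powR_ge0.
apply: (inner_prob_le_full mG PG) => w [/= dev box].
apply: generalization_gap_le => //.
apply: dev; apply: Theta_param_box.
by case: (minth (S ^~ w)) => -[].
Unshelve. all: by end_near.
Qed.

(** * Law of the data and conclusion *)

Lemma entry_le_opnorm (R : realType) (m n : nat) (A : 'M[R]_(m, n)) i j :
  `|A i j| <= opnorm A.
Proof.
pose e : 'cV[R]_n := \col_k (k == j)%:R.
have e1 : enorm e <= 1.
  rewrite /enorm (bigD1 j) //= big1 => [|k kj].
    by rewrite mxE eqxx expr1n addr0 sqrtr1.
  by rewrite mxE (negPf kj) expr0n.
have -> : A i j = (A *m e) i 0.
  rewrite mxE (bigD1 j) //= big1 => [|k kj]; first by rewrite mxE eqxx mulr1 addr0.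
  by rewrite mxE (negPf kj) mulr0.
apply: le_trans (entry_le_enorm _ _) _; apply: ub_le_sup; last by exists e.
exists (Num.sqrt (\sum_k (\sum_l `|A k l|) ^+ 2)) => _ [v v1 <-].
rewrite ler_wsqrtr // ler_sum // => k _.
rewrite -[leLHS]real_normK ?num_real // lerXn2r ?nnegrE //.
  by rewrite sumr_ge0.
rewrite mxE; apply: le_trans (ler_norm_sum _ _ _) _.
apply: ler_sum => l _; rewrite normrM ler_piMr //.
exact: le_trans (entry_le_enorm _ _) v1.
Qed.

Lemma opball0 (R : realType) (n : nat) : opball n 1 (0 : 'M[R]_n).
Proof.
have e0 : enorm (0 : 'cV[R]_n) = 0.
  by rewrite /enorm big1 ?sqrtr0 // => i _; rewrite mxE expr0n.
apply: (@le_trans _ _ 0) => //; apply: ge_sup => [|_ [v _ <-]].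
  exists (enorm ((0 : 'M[R]_n) *m (0 : 'cV[R]_n))); exists 0 => //=.
  by rewrite e0.
by rewrite mul0mx e0.
Qed.

Lemma enorm_le_sup_norm (R : realType) (n : nat) (f : 'M[R]_n -> 'cV[R]_n) X :
  (exists K : R, forall X, opball n 1 X -> enorm (f X) <= K) ->
  opball n 1 X -> enorm (f X) <= sup_norm f.
Proof.
by move=> [K fK] X1; apply: ub_le_sup; [exists K => _ [Y /fK ? <-]|exists X].
Qed.

(** Entries of M = X + E are at most 1/2 + 1/2 in absolute value, because an
    entry is bounded by the operator norm. *)
Lemma data_law_box (R : realType) (n : nat) (f : 'M[R]_n -> 'cV[R]_n)
    (f_bounded : exists K : R, forall X, opball n 1 X -> enorm (f X) <= K)
    (dO : measure_display) (Omega : measurableType dO) (P : probability Omega R)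
    (X E M : {RV P >-> 'M[R]_n}) (y : {RV P >-> 'cV[R]_n})
    (hX_ball : {ae P, forall w, opball n (1 / 2) (X w)})
    (hy : {ae P, forall w, y w = f (X w)})
    (hE_ball : {ae P, forall w, opball n (1 / 2) (E w)})
    (hM : forall w, M w = X w + E w) :
  0 <= sup_norm f /\
  distribution P (pair_fun M y) (data_box (sup_norm f)) = 1%E.
Proof.
have f0 : 0 <= sup_norm f.
  exact: le_trans (enorm_ge0 _) (enorm_le_sup_norm f_bounded (opball0 R n)).
split=> //; have mbox := @measurable_data_box R n _ f0.
set A := pair_fun M y @^-1` data_box (sup_norm f).
have mA : measurable A by exact: measurable_funPTI.
rewrite -[LHS]/(P A).
have PAC : P (~` A) = 0%E.
  apply: measure_negligible; first exact: measurableC.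
  have good : {ae P, forall w, [/\ opball n (1 / 2) (X w), y w = f (X w)
                                 & opball n (1 / 2) (E w)]}.
    by apply: filterS3 hX_ball hy hE_ball.
  apply: negligibleS good => w nAw [Xw yw Ew]; apply: nAw; split=> [i j|] /=.
    rewrite hM mxE; apply: le_trans (ler_normD _ _) _.
    have := le_trans (entry_le_opnorm (X w) i j) Xw.
    have := le_trans (entry_le_opnorm (E w) i j) Ew.
    lra.
  rewrite yw; apply: enorm_le_sup_norm => //.
  by apply: le_trans Xw _; lra.
by rewrite -[A]setCK probability_setC ?PAC ?sube0 //; exact: measurableC.
Qed.

Theorem theorem5p5 (R : realType) (n L : nat) (hn : (0 < n)%N) (hL : (0 < L)%N)
  (* network architecture *)
  (a : architecture R n L) (ha : admissible_architecture a)
  (c0 : R) (hc0 : 1 <= c0) (hc0a : fixed_weights_bound a c0)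
  (* target function *)
  (f : 'M[R]_n -> 'cV[R]_n)
  (f_bounded : exists K : R, forall X, opball n 1 X -> enorm (f X) <= K)
  (f_continuous : {within opball n 1, continuous f})
  (* direct map *)
  (d : nat) (B : set 'cV[R]_d) (hB : euclidean_ball B) (F : 'cV[R]_d -> 'M[R]_n)
  (* random data *)
  (dO : measure_display) (Omega : measurableType dO) (P : probability Omega R)
  (z : {RV P >-> 'cV[R]_d}) (X E M : {RV P >-> 'M[R]_n}) (y : {RV P >-> 'cV[R]_n})
  (sigma : R)
  (hz : forall w, B (z w))
  (hX : forall w, X w = F (z w))
  (hX_ball : {ae P, forall w, opball n (1 / 2) (X w)})
  (hy : {ae P, forall w, y w = f (X w)})
  (hXE : independent_RV X E)
  (hE_ball : {ae P, forall w, opball n (1 / 2) (E w)})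
  (hE_var : ('E_P[fun w => (\sum_(i < n) \sum_(j < n) `|E w i j| ^+ 2)%R]
             = (n%:R ^+ 2 * sigma ^+ 2)%:E)%E)
  (hM : forall w, M w = X w + E w) :
  let fsup := sup_norm f in
  let tau := distribution P (pair_fun M y) in
  (* (i) *)
  (forall (ap : option (R * R)) (alpha : R), 0 < alpha < 1 ->
     (forall eps0 R0, ap = Some (eps0, R0) ->
        exists th0 : param R n L,
          [/\ Theta th0, regularizer th0 = R0 & approximates a f (F @` B) eps0 th0]) ->
     let lr0 := Lr0 n L c0 sigma fsup alpha ap in
     let C1 := expR (164 * n%:R `^ (3 / 2) * L%:R ^+ 2 * c0 ^+ L.+1 * (1 + fsup)
                     * expR (4 * lr0 * alpha^-1)) in
     let C2 := 4 * n%:R * L%:R * c0 ^+ L * expR (3 * lr0 * alpha^-1) in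
     lr0 <= 4 * n%:R * fsup ^+ 2 /\ gap_bound a c0 fsup alpha lr0 tau C1 C2)
  /\
  (* (ii) *)
  (forall eps0 R0 alpha : R, 1 <= R0 -> 0 < alpha < 1 ->
     let lr0 := Lr0 n L c0 sigma fsup alpha (Some (eps0, R0)) in
     (exists th0 : param R n L,
        [/\ admissible_params c0 alpha lr0 th0, regularizer th0 = R0
          & approximates a f (F @` B) eps0 th0]) ->
     1 / R0 * (eps0 ^+ 2
       + 2 * L%:R ^+ 2 * c0 ^+ (2 * L) * expR (4 * R0) * (n%:R ^+ 2 * sigma ^+ 2))
       <= alpha ->
     exists C1 C2 : R,
       [/\ C1 <= 2 * expR (n%:R `^ (3 / 2) * 2 ^+ 10 * (1 + fsup) * (1 + R0)
                           * L%:R ^+ 3 * c0 ^+ L.+1 * expR (8 * R0)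
                           * (1 + R0 ^+ 2 * alpha `^ (- (1 / 2)))),
           C2 <= 16 * n%:R * L%:R * c0 ^+ L * expR (8 * R0)
                   * (1 + R0 ^+ 2 * alpha `^ (- (1 / 2)))
         & gap_bound a c0 fsup alpha lr0 tau C1 C2]).
Proof.
move=> fsup tau.
have [fsup0 tau1] := data_law_box f_bounded hX_ball hy hE_ball hM.
have gap c1 c2 alpha lr0 : 1 <= c1 -> 0 < c2 ->
    gap_bound a c0 fsup alpha lr0 tau c1 c2.
  exact: gap_bound_supported.
have n_gt0 : 0 < n%:R :> R by rewrite ltr0n.
have L_gt0 : 0 < L%:R :> R by rewrite ltr0n.
have c0_gt0 : 0 < c0 by exact: lt_le_trans hc0.
split.
  move=> ap alpha _ _ lr0 C1 C2; split.
    rewrite /lr0 /Lr0; case: (ap) => [[eps0 R0]|] //.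
    by rewrite ge_min lexx.
  apply: gap.
    rewrite /C1 -[leLHS]expR0 ler_expR.
    by rewrite !mulr_ge0 ?powR_ge0 ?expR_ge0 ?exprn_ge0 ?addr_ge0 ?(ltW c0_gt0).
  by rewrite /C2 !mulr_gt0 ?expR_gt0 ?exprn_gt0.
move=> eps0 R0 alpha R0_ge1 _ lr0 _ _.
have R0_ge0 : 0 <= R0 by exact: le_trans R0_ge1.
pose C2 := 16 * n%:R * L%:R * c0 ^+ L * expR (8 * R0)
           * (1 + R0 ^+ 2 * alpha `^ (- (1 / 2))).
exists 1, C2; split=> //.
  set x := _ * (1 + _).
  have x0 : 0 <= x.
    by rewrite !mulr_ge0 ?powR_ge0 ?expR_ge0 ?exprn_ge0 ?addr_ge0
      ?mulr_ge0 ?powR_ge0 ?exprn_ge0 ?(ltW c0_gt0).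
  have : 1 <= expR x by rewrite -[leLHS]expR0 ler_expR.
  lra.
apply: gap => //.
by rewrite !mulr_gt0 ?expR_gt0 ?exprn_gt0 // ltr_wpDr // mulr_ge0 ?powR_ge0 ?sqr_ge0.
Qed.
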